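(* Let $E$ be a Banach lattice such that $E_{(2)}$ is also a Banach lattice (i.e. the seminorm $\|\cdot\|_{(2)}$ is a complete norm on $E_{(2)}$). Then the map $T\colon E_{(2)}\to(E\otimes_{|\pi|}E)/I_{\rm oc}$ given by $Tx=x\otimes|x|+I_{\rm oc}$ is a surjective linear lattice isometry.
   Context: All Banach lattices are real. A lattice isometry is a linear lattice homomorphism that preserves the norm. Functional calculus: for $x_1,\dots,x_n$ in a Banach lattice $E$ there is a unique lattice homomorphism $\tau$ from the space of continuous homogeneous functions $f\colon\mathbb R^n\to\mathbb R$ (homogeneous: $f(\lambda t)=\lambda f(t)$ for all $\lambda\ge 0$) to $E$ sending the $i$-th coordinate function to $x_i$; one writes $f(x_1,\dots,x_n)=\tau(f)$. Convention: for $t\in\mathbb R$ and $p>0$, $t^p$ means $|t|^p\operatorname{sign}t$. 2-concavification: on $E$ define new operations $x\oplus y=(x^2+y^2)^{1/2}$ and $\alpha\odot x=\alpha^{1/2}x$ ($x,y\in E$, $\alpha\in\mathbb R$), with the signed-power convention. With these operations and the original order $E$ is a vector lattice, and $\|x\|_{(2)}=\inf\{\sum_{i=1}^n\|v_i\|^2 : |x|\le v_1\oplus\dots\oplus v_n,\ v_i\ge 0\}$ is a lattice seminorm on it. The resulting seminormed vector lattice is $E_{(2)}$; linearity of maps on $E_{(2)}$ is with respect to $\oplus,\odot$. Fremlin tensor product: for Banach lattices $E,F$, the norm of $u$ in the algebraic tensor product $E\otimes F$ is $\|u\|_{|\pi|}=\sup\|\hat\varphi(u)\|$, where the supremum is over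 all Banach lattices $G$ and all positive bilinear maps $\varphi\colon E\times F\to G$ (i.e. $\varphi(x,y)\ge 0$ whenever $x,y\ge 0$) with $\|\varphi\|=\sup\{\|\varphi(x,y)\|:\|x\|\le1,\|y\|\le1\}\le 1$, and $\hat\varphi$ is the induced linear map on $E\otimes F$. The completion of $E\otimes F$ in this norm is a Banach lattice (its positive cone is the closure of the convex cone generated by $x\otimes y$ with $x,y\ge0$), denoted $E\otimes_{|\pi|}F$. It has the universal property that continuous positive bilinear maps $\varphi\colon E\times F\to G$ correspond one-to-one and norm-preservingly to positive operators $T\colon E\otimes_{|\pi|}F\to G$ with $T(x\otimes y)=\varphi(x,y)$; $T$ is a lattice homomorphism if and only if $|\varphi(x,y)|=\varphi(|x|,|y|)$ for all $x,y$. $I_{\rm oc}$ denotes the norm closed order ideal of $E\otimes_{|\pi|}E$ generated by $\{x\otimes y : x,y\in E,\ x\perp y\}$. The quotient $(E\otimes_{|\pi|}E)/I_{\rm oc}$ carries the quotient norm and quotient order. *)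

(* Defs.v *)
From HB Require Import structures.
From mathcomp Require Import all_boot all_order all_algebra.
From mathcomp Require Import all_classical all_reals all_analysis.

Set Implicit Arguments.
Unset Strict Implicit.
Unset Printing Implicit Defensive.

Import Order.TTheory GRing.Theory Num.Theory.
Import numFieldNormedType.Exports.

Local Open Scope classical_set_scope.
Local Open Scope ring_scope.
Local Open Scope quotient_scope.

(* The order is not registered as a library order: in the library the join of  *)
(* a partial order with a normed Z-module is numDomainType, and with a lattice *)
(* realDomainType, so that no normed lattice can inherit from both.            *)
HB.mixin Record isVectorLattice (R : realType) V of GRing.Lmodule R V := {
  vle : rel V;
  vlexx : reflexive vle;
  vle_anti : antisymmetric vle;
  vle_trans : transitive vle;
  vle_add2r : forall x y z : V, vle x y -> vle (x + z) (y + z);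
  vscale_ge0 : forall (a : R) (x : V), 0 <= a -> vle 0 x -> vle 0 (a *: x);
  vmax : V -> V -> V;
  vmin : V -> V -> V;
  vmax_le : forall x y z : V, vle (vmax x y) z = vle x z && vle y z;
  vle_min : forall x y z : V, vle z (vmin x y) = vle z x && vle z y
}.

#[short(type="vectorLatticeType")]
HB.structure Definition VectorLattice (R : realType) :=
  {V of GRing.Lmodule R V & isVectorLattice R V}.

Declare Scope vlattice_scope.
Delimit Scope vlattice_scope with VL.
Local Open Scope vlattice_scope.

Notation "x <=| y" := (vle x y) (at level 70, y at next level) : vlattice_scope.
Notation "x \vee y" := (vmax x y) (at level 48, left associativity)
  : vlattice_scope.
Notation "x \wedge y" := (vmin x y) (at level 48, left associativity)
  : vlattice_scope.

Section VectorLatticeDefs.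
Context {R : realType} {V : vectorLatticeType R}.
Implicit Types x y : V.

(* The lattice absolute value, not to be confused with the norm `|x|.          *)
Definition vabs x : V := x \vee - x.

Definition vdisjoint x y : Prop := vabs x \wedge vabs y = 0.

Definition is_solid (J : set V) : Prop :=
  forall x y, J y -> vabs x <=| vabs y -> J x.

End VectorLatticeDefs.

HB.mixin Record isBanachLattice (R : realType) E
    of CompleteNormedModule R E & VectorLattice R E := {
  ler_vnorm : forall x y : E, vabs x <=| vabs y -> `|x| <= `|y| :> R
}.

#[short(type="banachLatticeType")]
HB.structure Definition BanachLattice (R : realType) :=
  {E of CompleteNormedModule R E & VectorLattice R E & isBanachLattice R E}.

(* Continuous positively homogeneous functions R^n -> R.                       *)
Definition homogeneous_continuous (R : realType) n : set ('rV[R]_n -> R) :=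
  [set f | continuous f /\
    forall (a : R) (t : 'rV[R]_n), 0 <= a -> f (a *: t) = a * f t].

Section FunctionalCalculus.
Context {R : realType} {E : banachLatticeType R} {n : nat}.

(* tau is a linear lattice homomorphism on the continuous homogeneous          *)
(* functions (its other values are irrelevant), and sends the i-th coordinate  *)
(* function to x i.                                                            *)
Definition is_calculus (x : 'I_n -> E) (tau : ('rV[R]_n -> R) -> E) : Prop :=
  [/\ forall (a : R) f g, homogeneous_continuous f -> homogeneous_continuous g ->
        tau (fun t => a * f t + g t) = a *: tau f + tau g,
      forall f g, homogeneous_continuous f -> homogeneous_continuous g ->
        tau (fun t => Num.max (f t) (g t)) = tau f \vee tau g,
      forall f g, homogeneous_continuous f -> homogeneous_continuous g ->
        tau (fun t => Num.min (f t) (g t)) = tau f \wedge tau g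
    & forall i, tau (fun t => t 0 i) = x i].

(* f(x_1, ..., x_n), for f continuous and homogeneous.                         *)
Definition calculus (x : 'I_n -> E) (f : 'rV[R]_n -> R) : E :=
  xget 0 [set y | exists2 tau, is_calculus x tau & y = tau f].

End FunctionalCalculus.

(* The signed power t^p = |t|^p sign t.                                        *)
Definition spow (R : realType) (t p : R) : R := Num.sg t * `|t| `^ p.

(* The 2-concavification E_(2) has the same carrier and order as E; cv_add,    *)
(* cv_scale and cv_norm are its addition, scalar multiplication and seminorm.  *)
Section Concavification.
Context {R : realType} {E : banachLatticeType R}.
Implicit Types (x y : E) (a : R).

Definition cv_add x y : E :=
  calculus (fun i : 'I_2 => if i == 0 then x else y)
    (fun t => spow (spow (t 0 0) 2 + spow (t 0 1) 2) 2^-1).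

Definition cv_scale a x : E := spow a 2^-1 *: x.

Definition cv_sub x y : E := cv_add x (cv_scale (-1) y).

Definition cv_norm x : R :=
  inf [set r | exists n (v : 'I_n -> E),
    [/\ forall i, 0 <=| v i,
        vabs x <=| \big[cv_add/0]_(i < n) v i
      & r = \sum_(i < n) `|v i| ^+ 2]].

End Concavification.

Definition concavification_is_Banach (R : realType) (E : banachLatticeType R)
    : Prop :=
  (forall x : E, cv_norm x = 0 -> x = 0) /\
  (forall u : nat -> E,
    (forall e : R, 0 < e -> exists N, forall m n, (N <= m)%N -> (N <= n)%N ->
       cv_norm (cv_sub (u m) (u n)) < e) ->
    exists l : E, forall e : R, 0 < e -> exists N, forall n, (N <= n)%N ->
       cv_norm (cv_sub (u n) l) < e).

Section Fremlin.
Context {R : realType}.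

Definition positive_bilinear (E F G : vectorLatticeType R)
    (phi : {bilinear E -> F -> G}) : Prop :=
  forall x y, 0 <=| x -> 0 <=| y -> 0 <=| phi x y.

(* phi^ (u), for u = sum of the x (x) y with (x, y) ranging over s.            *)
Definition tensor_eval (E F G : lmodType R) (phi : {bilinear E -> F -> G})
    (s : seq (E * F)) : G :=
  \sum_(p <- s) phi p.1 p.2.

(* The norm of the element of the algebraic tensor product represented by s.   *)
Definition fremlin_norm (E F : banachLatticeType R) (s : seq (E * F)) : R :=
  sup [set r | exists (G : banachLatticeType R) (phi : {bilinear E -> F -> G}),
    [/\ positive_bilinear phi,
        forall x y, `|x| <= 1 -> `|y| <= 1 -> `|phi x y| <= 1
      & r = `|tensor_eval phi s|]].

(* (P, tens) is the Fremlin tensor product of E and F: tens induces an         *)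
(* isometry of the algebraic tensor product, normed by fremlin_norm, onto a    *)
(* dense subspace of the (complete) space P, whose positive cone is the        *)
(* closure of the convex cone generated by the tens x y with x, y >= 0.        *)
(* This determines (P, tens) up to a unique isometric lattice isomorphism.     *)
Definition is_fremlin_tensor (E F P : banachLatticeType R)
    (tens : {bilinear E -> F -> P}) : Prop :=
  [/\ forall s, `|tensor_eval tens s| = fremlin_norm s,
      closure (range (tensor_eval tens)) = setT
    & [set u : P | 0 <=| u] =
      closure [set u | exists2 s : seq (E * F),
        (forall p, p \in s -> 0 <=| p.1 /\ 0 <=| p.2)
        & u = tensor_eval tens s]].

End Fremlin.

Record orderIdeal (R : realType) (V : vectorLatticeType R) := OrderIdeal {
  ideal_pred :> {pred V};
  ideal_submod : submod_closed ideal_pred;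
  ideal_solid : is_solid [set` ideal_pred]
}.

Section VectorLatticeTheory.
Context {R : realType} {V : vectorLatticeType R}.
Implicit Types x y z : V.

Lemma vle_trans' y x z : x <=| y -> y <=| z -> x <=| z.
Proof. exact: vle_trans. Qed.

Lemma vle_add2rE z x y : (x + z <=| y + z) = (x <=| y).
Proof.
by apply/idP/idP => [/(@vle_add2r _ _ _ _ (- z))|/vle_add2r//]; rewrite !addrK.
Qed.

Lemma vle_add2lE z x y : (z + x <=| z + y) = (x <=| y).
Proof. by rewrite ![z + _]addrC vle_add2rE. Qed.

Lemma vle_sub x y : (0 <=| y - x) = (x <=| y).
Proof. by rewrite -(vle_add2rE x) add0r subrK. Qed.

Lemma vle_opp2 x y : (- x <=| - y) = (y <=| x).
Proof. by rewrite -vle_sub opprK addrC vle_sub. Qed.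

Lemma vle_add x y z t : x <=| y -> z <=| t -> x + z <=| y + t.
Proof.
move=> xy zt; apply: (@vle_trans' (y + z)); first by rewrite vle_add2rE.
by rewrite vle_add2lE.
Qed.

Lemma vmaxl x y : x <=| x \vee y.
Proof. by have := vlexx (x \vee y); rewrite vmax_le => /andP[]. Qed.

Lemma vmaxr x y : y <=| x \vee y.
Proof. by have := vlexx (x \vee y); rewrite vmax_le => /andP[]. Qed.

Lemma vabs_le x y : (vabs x <=| y) = (x <=| y) && (- x <=| y).
Proof. exact: vmax_le. Qed.

Lemma ler_vabs x : x <=| vabs x. Proof. exact: vmaxl. Qed.

Lemma lerN_vabs x : - x <=| vabs x. Proof. exact: vmaxr. Qed.

Lemma vabsN x : vabs (- x) = vabs x.
Proof.
apply: vle_anti; rewrite !vabs_le opprK.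
have := lerN_vabs (- x); rewrite opprK => ->.
by rewrite !ler_vabs lerN_vabs.
Qed.

Lemma vabs_ge0 x : 0 <=| vabs x.
Proof.
have := vle_add (ler_vabs x) (lerN_vabs x); rewrite subrr => h.
have h2 : 0 <= 2^-1 :> R by rewrite invr_ge0.
have := vscale_ge0 _ _ h2 h.
by rewrite -mulr2n -(scaler_nat 2 (vabs x)) scalerA mulVf ?pnatr_eq0// scale1r.
Qed.

Lemma vabs_ge0_id x : 0 <=| x -> vabs x = x.
Proof.
move=> x0; apply: vle_anti; rewrite ler_vabs vabs_le vlexx /= andbT.
by apply: (vle_trans' _ x0); rewrite -vle_sub opprK add0r.
Qed.

Lemma vle_subl_abs x y : x <=| y + vabs (x - y).
Proof. by rewrite -(vle_add2rE (- y)) addrAC subrr add0r ler_vabs. Qed.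

Lemma vabs_subC x y : vabs (x - y) = vabs (y - x).
Proof. by rewrite -opprB vabsN. Qed.

Lemma vabs_maxB x y z : vabs (x \vee z - y \vee z) <=| vabs (x - y).
Proof.
have h u v : u \vee z - v \vee z <=| vabs (u - v).
  rewrite -(vle_add2rE (v \vee z)) subrK vmax_le; apply/andP; split.
    rewrite addrC; apply: (vle_trans' (vle_subl_abs u v)).
    by rewrite vle_add2rE vmaxl.
  rewrite -[X in X <=| _]add0r; apply: vle_add; [exact: vabs_ge0|exact: vmaxr].
by rewrite vabs_le h/= opprB vabs_subC h.
Qed.

Lemma vmaxC x y : x \vee y = y \vee x.
Proof. by apply: vle_anti; rewrite !vmax_le !(vmaxl, vmaxr). Qed.

End VectorLatticeTheory.

(* The quotient of a vector lattice by an order ideal; the underlying quotient *)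
(* group is the library's.                                                     *)
Module VLQuotient.
Section Quotient.
Context {R : realType} {V : vectorLatticeType R} (I : orderIdeal V).

#[export]
HB.instance Definition _ :=
  GRing.isSubmodClosed.Build R V (ideal_pred I) (ideal_submod I).

Definition quot : Type := Quotient.quot (ideal_pred I : zmodClosed V).

#[export]
HB.instance Definition _ := Quotient.on quot.
#[export]
HB.instance Definition _ := GRing.Zmodule.on quot.

Implicit Types (x y z : V) (u v w : quot).
Local Notation proj := (\pi_quot : V -> quot).

Lemma piP x y : proj x = proj y <-> x - y \in ideal_pred I.
Proof.
rewrite (Quotient.idealrBE (ideal_pred I : zmodClosed V)).
by split=> [->|/eqP].
Qed.

Lemma piD x y : proj (x + y) = proj x + proj y.
Proof. exact: Quotient.pi_add. Qed.

Lemma piN x : proj (- x) = - proj x.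
Proof. exact: Quotient.pi_opp. Qed.

Lemma piB x y : proj (x - y) = proj x - proj y.
Proof. by rewrite piD piN. Qed.

Lemma pi0 : proj 0 = 0.
Proof. by rewrite -(subrr 0) piB subrr. Qed.

Lemma pi_surj u : exists x, u = proj x.
Proof. by exists (repr u); rewrite reprK. Qed.

Lemma solidP x y : y \in ideal_pred I -> vabs x <=| vabs y ->
  x \in ideal_pred I.
Proof. exact: ideal_solid. Qed.

Definition scale (a : R) u : quot := proj (a *: repr u).

Lemma piZ a x : proj (a *: x) = scale a (proj x).
Proof.
apply/piP; rewrite -scalerBr; apply: (rpredZ (s := ideal_pred I)).
by apply/piP; rewrite reprK.
Qed.

Fact scalerA a b u : scale a (scale b u) = scale (a * b) u.
Proof. by have [x ->] := pi_surj u; rewrite -!piZ scalerA. Qed.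

Fact scale1r : left_id 1 scale.
Proof. by move=> u; have [x ->] := pi_surj u; rewrite -piZ scale1r. Qed.

Fact scalerDr : right_distributive scale +%R.
Proof.
move=> a u v; have [x ->] := pi_surj u; have [y ->] := pi_surj v.
by rewrite -piD -!piZ scalerDr piD.
Qed.

Fact scalerDl u : {morph scale^~ u : a b / a + b}.
Proof. by move=> a b; have [x ->] := pi_surj u; rewrite -!piZ scalerDl piD. Qed.

#[export]
HB.instance Definition _ :=
  GRing.Zmodule_isLmodule.Build R quot scalerA scale1r scalerDr scalerDl.

(* The positive cone is the image of the positive cone of V.                   *)
Definition le u v : bool := `[< exists2 p : V, 0 <=| p & v - u = proj p >].

Definition max u v : quot := proj (repr u \vee repr v).

Definition min u v : quot := - max (- u) (- v).

Lemma pi_le x y : x <=| y -> le (proj x) (proj y).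
Proof. by move=> xy; apply/asboolP; exists (y - x); rewrite ?piB// vle_sub. Qed.

Lemma pi_max x y : proj (x \vee y) = max (proj x) (proj y).
Proof.
have h a b c : proj a = proj b -> proj (a \vee c) = proj (b \vee c).
  by move=> /piP abI; apply/piP; apply: (solidP abI); apply: vabs_maxB.
rewrite /max (h x (repr (proj x)) y) ?reprK// ![repr (proj x) \vee _]vmaxC.
by rewrite (h y (repr (proj y))) ?reprK.
Qed.

Fact le_refl : reflexive le.
Proof. by move=> u; apply/asboolP; exists 0; rewrite ?pi0 ?subrr ?vlexx. Qed.

Fact le_anti : antisymmetric le.
Proof.
move=> u v /andP[/asboolP[p p0 pE] /asboolP[q q0 qE]].
apply/esym/eqP; rewrite -subr_eq0 pE -pi0; apply/eqP/piP; rewrite subr0.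
have pq : p + q \in ideal_pred I.
  by rewrite -[_ + _]subr0; apply/piP; rewrite piD -pE -qE pi0 addrA subrK subrr.
apply: (solidP pq); rewrite !vabs_ge0_id//.
  by rewrite -[X in X <=| _]addr0 vle_add2lE.
by rewrite -[X in X <=| _]addr0; apply: vle_add.
Qed.

Fact le_trans : transitive le.
Proof.
move=> v u w /asboolP[p p0 pE] /asboolP[q q0 qE].
apply/asboolP; exists (q + p); last by rewrite piD -pE -qE addrA subrK.
by rewrite -[X in X <=| _]addr0; apply: vle_add.
Qed.

Fact le_add2r u v w : le u v -> le (u + w) (v + w).
Proof.
by move=> /asboolP[p p0 pE]; apply/asboolP; exists p => //; rewrite opprD addrACA subrr addr0.
Qed.

Fact scale_ge0 (a : R) u : 0 <= a -> le 0 u -> le 0 (a *: u).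
Proof.
move=> a0 /asboolP[p p0 /[!subr0] pE]; apply/asboolP; exists (a *: p).
  exact: (vscale_ge0 a).
by rewrite subr0 pE piZ.
Qed.

Fact max_le u v w : le (max u v) w = le u w && le v w.
Proof.
have [x ->] := pi_surj u; have [y ->] := pi_surj v; have [z ->] := pi_surj w.
rewrite -pi_max; apply/idP/andP=> [h|[]].
  by split; apply: le_trans h; apply: pi_le; [exact: vmaxl|exact: vmaxr].
move=> /asboolP[p p0 pE] /asboolP[q q0 qE].
have -> : proj z = proj ((x + p) \vee (y + q)).
  rewrite pi_max !piD -pE -qE ![_ + (proj z - _)]addrC !subrK -pi_max.
  congr (\pi _); apply: vle_anti.
  by rewrite vmaxl vmax_le vlexx.
apply: pi_le; rewrite vmax_le; apply/andP; split.
  apply: (vle_trans' _ (vmaxl _ _)).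
  by rewrite -[X in X <=| _]addr0 vle_add2lE.
apply: (vle_trans' _ (vmaxr _ _)).
by rewrite -[X in X <=| _]addr0 vle_add2lE.
Qed.

Lemma le_opp2 u v : le (- u) (- v) = le v u.
Proof.
have h a b : le a b -> le (- b) (- a).
  by move=> /asboolP[p p0 pE]; apply/asboolP; exists p; rewrite // opprK addrC.
by apply/idP/idP => /h//; rewrite !opprK.
Qed.

Fact le_min u v w : le w (min u v) = le w u && le w v.
Proof. by rewrite /min -le_opp2 opprK max_le !le_opp2. Qed.

#[export]
HB.instance Definition _ := isVectorLattice.Build R quot
  le_refl le_anti le_trans le_add2r scale_ge0 max_le le_min.

End Quotient.
Module Exports. HB.reexport. End Exports.
End VLQuotient.
Export VLQuotient.Exports.

Notation vlquot := VLQuotient.quot.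

Section QuotientNorm.
Context {R : realType} {E : banachLatticeType R} (I : orderIdeal E).

Definition quot_class (x : E) : vlquot I := \pi_(vlquot I) x.

Definition quot_norm (u : vlquot I) : R :=
  inf [set `|x| | x in [set x | quot_class x = u]].

End QuotientNorm.

Section ClosedIdeal.
Context {R : realType} {E : banachLatticeType R} (A : set E).

Definition closed_ideal_pred : {pred E} :=
  fun u => `[< forall I : orderIdeal E,
    closed [set` I] -> A `<=` [set` I] -> u \in ideal_pred I >].

Fact closed_ideal_submod : submod_closed closed_ideal_pred.
Proof.
split=> [|a u v /asboolP uI /asboolP vI]; apply/asboolP => I cI AI.
  exact: (ideal_submod I).1.
by apply: (ideal_submod I).2; [exact: uI|exact: vI].
Qed.

Fact closed_ideal_solid : is_solid [set` closed_ideal_pred].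
Proof.
move=> x y /asboolP yI xy; apply/asboolP => I cI AI.
by apply: (ideal_solid (yI I cI AI)).
Qed.

(* The smallest norm closed order ideal containing A.                          *)
Definition closed_ideal : orderIdeal E :=
  OrderIdeal closed_ideal_submod closed_ideal_solid.

End ClosedIdeal.

Definition I_oc (R : realType) (E P : banachLatticeType R)
    (tens : {bilinear E -> E -> P}) : orderIdeal P :=
  closed_ideal [set u | exists x y : E, vdisjoint x y /\ u = tens x y].

(* Main.v *)
(* The geometric mean (x y)^(1/2) is a contractive positive bilinear map from  *)
(* E x E to E_(2): the bound on ||(x y)^(1/2)||_(2) is the inequality          *)
(* (st)^(1/2) <= ((s^2 + t^2)/2)^(1/2). Hence it induces a positive            *)
(* contraction S from the Fremlin tensor product to E_(2), which vanishes on   *)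
(* I_oc and satisfies S (x (x) |x|) = x. Conversely, modulo I_oc a sum of      *)
(* x_i (x) y_i only depends on the function sum_i w(x_i) w(y_i) of the         *)
(* real-valued lattice homomorphisms w on a principal ideal containing the     *)
(* x_i and y_i: use a partition of unity of a unit of that ideal and discard   *)
(* the products of its disjoint members. Therefore T is linear and monotone,   *)
(* and T (S u) = u + I_oc, first for u in the algebraic tensor product and     *)
(* then by density. So S induces the inverse of T; both are positive           *)
(* contractions, so T is an isometric order isomorphism, hence also a lattice  *)
(* homomorphism. Identities in E reduce to identities between real numbers,    *)
(* since by Zorn's lemma the lattice homomorphisms on a principal ideal        *)
(* separate its points; with the lattice Stone-Weierstrass theorem they also   *)
(* yield the functional calculus.                                              *)

Require Import Defs.
From HB Require Import structures.
From mathcomp Require Import all_boot all_order all_algebra.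
From mathcomp Require Import all_classical all_reals all_analysis.
From mathcomp Require Import finmap ring lra.

Import Order.TTheory GRing.Theory Num.Theory.
Import numFieldNormedType.Exports.

Set Implicit Arguments.
Unset Strict Implicit.
Unset Printing Implicit Defensive.

Local Open Scope classical_set_scope.
Local Open Scope ring_scope.
Local Open Scope vlattice_scope.

(** * Vector lattices *)

(** At a real-valued lattice homomorphism [w], the signed square of the geometric mean of [x] and
    [y] is the product of [w x] and [w y], and the signed square turns the addition of $E_{(2)}$
    into addition of numbers. So the geometric mean is bilinear into $E_{(2)}$. It is also positive
    and contractive ([cv_norm_gmean]), and [fremlin_universal] extends it to a positive contraction
    $S$ with $S(x\otimes|x|)=x$ that kills $I_{\rm oc}$ ([inverse_vanishes]). Thus $S$ sends every
    representative of $Tx$ to $x$, which gives $\|x\|_{(2)}\le\|Tx\|$ and shows that $T$ reflects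
    the order.

    The converse rests on [orthosymmetric_ge0]: for a positive bilinear map that vanishes on
    disjoint pairs and has an Archimedean target, the sign of $\sum B(x_i,y_i)$ is controlled by the
    numbers $\sum w(x_i)w(y_i)$. Applied to the class of $x\otimes y$ it yields additivity and
    monotonicity of $T$ and the identity $T((xy)^{1/2})=x\otimes y+I_{\rm oc}$. By density $TS$ is
    then the quotient map, so $T$ is onto. A cover of $|x|$ by $v_1\oplus\dots\oplus v_n$ lifts to
    $\sum v_i\otimes v_i$, which gives $\|Tx\|\le\|x\|_{(2)}$ ([square_class_norm_le]). An order
    isomorphism preserves suprema and infima.

    Two tools let computations in $E$ be done with numbers: characters of a principal ideal separate
    its points ([character_eq]), and they commute with the functional calculus ([calculusP]). *)

Section VectorLatticeComplements.
Context {R : realType} {V : vectorLatticeType R}.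
Implicit Types (x y z u v : V) (a b : R).

Lemma vle_add0 x y : 0 <=| x -> 0 <=| y -> 0 <=| x + y.
Proof. by move=> x0 y0; rewrite -[0]addr0; exact: vle_add. Qed.

Lemma vle_addr x y : 0 <=| y -> x <=| x + y.
Proof. by move=> y0; rewrite -[X in X <=| _]addr0 vle_add2lE. Qed.

Lemma vle_addl x y : 0 <=| y -> x <=| y + x.
Proof. by rewrite addrC; exact: vle_addr. Qed.

Lemma vle_subLR x y z : (x - y <=| z) = (x <=| z + y).
Proof. by rewrite -(vle_add2rE y) subrK. Qed.

Lemma vle_subRL x y z : (x <=| y - z) = (x + z <=| y).
Proof. by rewrite -(vle_add2rE z) subrK. Qed.

Lemma vle_oppl x y : (- x <=| y) = (- y <=| x).
Proof. by rewrite -vle_opp2 opprK. Qed.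

Lemma vle_eq x y : x <=| y -> y <=| x -> x = y.
Proof. by move=> xy yx; apply: vle_anti; rewrite xy. Qed.

Lemma vscale_le a x y : 0 <= a -> x <=| y -> a *: x <=| a *: y.
Proof.
by move=> a0; rewrite -vle_sub => xy; rewrite -vle_sub -scalerBr; exact: vscale_ge0.
Qed.

Lemma vscale_lel a b x : 0 <=| x -> a <= b -> a *: x <=| b *: x.
Proof.
by move=> x0; rewrite -subr_ge0 => ab; rewrite -vle_sub -scalerBl; exact: vscale_ge0.
Qed.

Lemma vmax_eqr x y : x <=| y -> x \vee y = y.
Proof. by move=> xy; apply: vle_eq; rewrite ?vmaxr// vmax_le xy vlexx. Qed.

Lemma vminl x y : x \wedge y <=| x.
Proof. by have := vlexx (x \wedge y); rewrite vle_min => /andP[]. Qed.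

Lemma vminr x y : x \wedge y <=| y.
Proof. by have := vlexx (x \wedge y); rewrite vle_min => /andP[]. Qed.

Lemma vmaxDr x y z : (x \vee y) + z = (x + z) \vee (y + z).
Proof.
apply: vle_eq; last by rewrite vmax_le !vle_add2rE vmaxl vmaxr.
by rewrite -(vle_add2rE (- z)) addrK vmax_le !vle_subRL vmaxl vmaxr.
Qed.

Lemma vminE x y : x \wedge y = - (- x \vee - y).
Proof.
apply: vle_eq.
  by rewrite -vle_opp2 opprK vmax_le !vle_opp2 vminl vminr.
by rewrite vle_min -vle_opp2 opprK vmaxl -vle_opp2 opprK vmaxr.
Qed.

Lemma vminC x y : x \wedge y = y \wedge x.
Proof. by rewrite !vminE vmaxC. Qed.

Lemma vmin_eqr x y : y <=| x -> x \wedge y = y.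
Proof. by move=> yx; apply: vle_eq; rewrite ?vminr// vle_min yx vlexx. Qed.

Lemma vmin_eql x y : x <=| y -> x \wedge y = x.
Proof. by rewrite vminC; exact: vmin_eqr. Qed.

Lemma vminDr x y z : (x \wedge y) + z = (x + z) \wedge (y + z).
Proof. by rewrite !vminE !opprD -vmaxDr opprD opprK. Qed.

Lemma vscale_max a x y : 0 <= a -> a *: (x \vee y) = (a *: x) \vee (a *: y).
Proof.
rewrite le_eqVlt => /predU1P[<-|a0].
  by rewrite !scale0r; apply: vle_eq; rewrite ?vmaxl// vmax_le vlexx.
apply: vle_eq; last by rewrite vmax_le !vscale_le ?ltW ?vmaxl ?vmaxr.
rewrite -[X in _ <=| X](scale1r) -(mulfV (lt0r_neq0 a0)) -scalerA.
apply: vscale_le (ltW a0) _.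
rewrite vmax_le -[X in X <=| _ ](scale1r x) -[X in _ && (X <=| _)](scale1r y).
by rewrite -(mulVf (lt0r_neq0 a0)) -!scalerA !vscale_le ?invr_ge0 ?ltW ?vmaxl ?vmaxr.
Qed.

Lemma vscale_min a x y : 0 <= a -> a *: (x \wedge y) = (a *: x) \wedge (a *: y).
Proof. by move=> a0; rewrite !vminE scalerN vscale_max// !scalerN. Qed.

Lemma vabsD x y : vabs (x + y) <=| vabs x + vabs y.
Proof. by rewrite vabs_le opprD !vle_add ?ler_vabs ?lerN_vabs. Qed.

Lemma vabsZ a x : vabs (a *: x) = `|a| *: vabs x.
Proof.
have h b : 0 <= b -> vabs (b *: x) = b *: vabs x.
  by move=> b0; rewrite /vabs vscale_max// scalerN.
have [a0|a0] := leP 0 a; first by rewrite ger0_norm// h.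
by rewrite ltr0_norm// -h ?oppr_ge0 ?ltW// scaleNr vabsN.
Qed.

Lemma vabs0 : vabs (0 : V) = 0.
Proof. by rewrite vabs_ge0_id// vlexx. Qed.

Lemma vabs_id x : vabs (vabs x) = vabs x.
Proof. by rewrite vabs_ge0_id// vabs_ge0. Qed.

Lemma vabs_bound x y : x <=| y -> - x <=| y -> vabs x <=| y.
Proof. by move=> xy yx; rewrite vabs_le xy. Qed.

Lemma vabs_maxB2 x y u v :
  vabs (x \vee y - u \vee v) <=| vabs (x - u) + vabs (y - v).
Proof.
have -> : x \vee y - u \vee v = (x \vee y - u \vee y) + (u \vee y - u \vee v).
  by rewrite addrA subrK.
apply: vle_trans' (vabsD _ _) _; apply: vle_add; first exact: vabs_maxB.
by rewrite ![u \vee _]vmaxC vabs_maxB.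
Qed.

Definition vpos x : V := x \vee 0.

Lemma vpos_ge0 x : 0 <=| vpos x. Proof. exact: vmaxr. Qed.

Lemma vpos_ge x : x <=| vpos x. Proof. exact: vmaxl. Qed.

Lemma vpos_eq0 x : (vpos x = 0) <-> (x <=| 0).
Proof.
split=> [<-|]; first exact: vmaxl.
by move=> x0; rewrite /vpos vmax_eqr.
Qed.

Lemma vposB x : vpos x - vpos (- x) = x.
Proof.
rewrite {2}/vpos -[X in _ \vee X](subrr x) -[X in X \vee _]add0r -vmaxDr.
by rewrite vmaxC opprD opprK addrA subrr add0r.
Qed.

Lemma vpos_disj x : vpos x \wedge vpos (- x) = 0.
Proof.
have -> : vpos x = x + vpos (- x) by rewrite -{2}(vposB x) subrK.
rewrite -{2}[vpos (- x)]add0r -vminDr vminE oppr0.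
by rewrite -/(vpos _) addrC subrr.
Qed.

(** This keeps an element disjoint from [y] when [y] is enlarged by a scalar factor. *)
Lemma vmin_scale_le a x y : 0 <=| x -> 1 <= a ->
  x \wedge (a *: y) <=| a *: (x \wedge y).
Proof.
move=> x0 a1; rewrite vscale_min ?(le_trans ler01)// vle_min vminr andbT.
apply: vle_trans' (vminl _ _) _.
by rewrite -{1}[x]scale1r vscale_lel.
Qed.

End VectorLatticeComplements.

(** * Maximal ideals and real-valued lattice homomorphisms *)

Section Ideals.
Context {R : realType} {V : vectorLatticeType R}.
Implicit Types (x y z u v e : V) (a b : R) (M : set V).

(** Membership in the principal ideal generated by [e]. A Banach lattice need not have an order
    unit, so arguments with real-valued homomorphisms take place inside such an ideal. *)
Definition dominated e x : Prop := exists c : R, vabs x <=| c *: e.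

Lemma dominated_pos e x : 0 <=| e -> dominated e x ->
  exists2 c : R, 0 < c & vabs x <=| c *: e.
Proof.
move=> e0 [c xc]; exists (`|c| + 1); first by rewrite ltr_wpDl.
apply: vle_trans' xc _; apply: vscale_lel => //.
by rewrite (le_trans (ler_norm _))// lerDl.
Qed.

Definition is_ideal M : Prop :=
  [/\ M 0, forall a x y, M x -> M y -> M (a *: x + y) & is_solid M].

Lemma dominated_ideal e : 0 <=| e -> is_ideal (dominated e).
Proof.
move=> e0; split=> [|a x y [c xc] [d yd]|x y [c yc] xy].
- by exists 0; rewrite vabs0 scale0r vlexx.
- exists (`|a| * c + d); apply: vle_trans' (vabsD _ _) _.
  by rewrite scalerDl vle_add// vabsZ -scalerA vscale_le.
- by exists c; exact: vle_trans' yc.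
Qed.

Lemma idealD M x y : is_ideal M -> M x -> M y -> M (x + y).
Proof. by move=> [_ + _] Mx My => /(_ 1 x y Mx My); rewrite scale1r. Qed.

Lemma idealZ M a x : is_ideal M -> M x -> M (a *: x).
Proof. by move=> [M0 + _] Mx => /(_ a x 0 Mx M0); rewrite addr0. Qed.

Lemma idealN M x : is_ideal M -> M x -> M (- x).
Proof. by move=> iM Mx; rewrite -scaleN1r; exact: idealZ. Qed.

Lemma ideal_abs M x : is_ideal M -> M x -> M (vabs x).
Proof. by move=> [_ _ +] Mx; apply; first exact: Mx; rewrite vabs_id vlexx. Qed.

Lemma ideal_le M x y : is_ideal M -> M y -> 0 <=| x -> x <=| y -> M x.
Proof.
move=> [_ _ sM] My x0 xy; apply: (sM _ _ My).
by rewrite !vabs_ge0_id//; exact: vle_trans' xy.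
Qed.

Lemma ideal_sandwich M x y z : is_ideal M -> M x -> M z -> x <=| y -> y <=| z -> M y.
Proof.
move=> iM Mx Mz xy yz; rewrite -(subrK x y); apply: idealD => //.
apply: (@ideal_le _ _ (z - x)) => //; last by rewrite vle_add2rE.
  by apply: idealD => //; exact: idealN.
by rewrite vle_sub.
Qed.

(** The last clause makes maximality among the ideals without [e] explicit: the ideal generated by
    [M] and one further element [u] already contains [e]. *)
Definition avoids_maximally e M : Prop :=
  [/\ is_ideal M, ~ M e &
    forall u, ~ M u -> exists m k, [/\ M m, 0 <= k & e <=| m + k *: vabs u]].

Lemma ideal_avoiding e M0 : is_ideal M0 -> ~ M0 e ->
  exists M, M0 `<=` M /\ avoids_maximally e M.
Proof.
move=> iM0 M0e.
(* Zorn's lemma also asks for the union of the empty chain. Putting the condition on the union with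
   [M0] lets the empty set qualify. *)
pose P (M : set V) := [/\ is_ideal (M0 `|` M) & ~ (M0 `|` M) e].
have [F FP Ft|A [[iA Ae] maxA]] := @Zorn_bigcup V P.
  have cover x y : (M0 `|` \bigcup_(X in F) X) x ->
      (M0 `|` \bigcup_(X in F) X) y ->
      exists2 X, (X = set0 \/ F X) & (M0 `|` X) x /\ (M0 `|` X) y.
    move=> [M0x|[X FX Xx]] [M0y|[Y FY Yy]].
    - by exists set0; [left|split; left].
    - by exists Y; [right|split; [left|right]].
    - by exists X; [right|split; [right|left]].
    - by have [XY|YX] := Ft _ _ FX FY; [exists Y|exists X]; try (by right);
        split; right => //; [exact: XY|exact: YX].
  have PX X : X = set0 \/ F X -> P X.
    by move=> [->|/FP//]; rewrite /P setU0.
  have sub X : X = set0 \/ F X -> M0 `|` X `<=` M0 `|` \bigcup_(X in F) X.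
    by move=> [->|FX] x [|]; [left|by []|left|right; exists X].
  split; [split|].
  - by left; case: iM0.
  - move=> a x y Mx My; have [X FX [Xx Xy]] := cover _ _ Mx My.
    by have [[_ lX _] _] := PX _ FX; apply: (sub _ FX); exact: lX.
  - move=> x y Mx xy; have [X FX [Xx _]] := cover _ _ Mx Mx.
    by have [[_ _ sX] _] := PX _ FX; apply: (sub _ FX); exact: sX xy.
  - move=> Me; have [X FX [Xe _]] := cover _ _ Me Me.
    by have [_] := PX _ FX.
exists (M0 `|` A); split; first by move=> x; left.
split=> // u Mu; apply: contrapT => nex.
(* The ideal generated by the maximal one and [u]; if it missed [e] it would contradict
   maximality. *)
pose B := [set x | exists m k, [/\ (M0 `|` A) m, 0 <= k & vabs x <=| m + k *: vabs u]].
have AB : M0 `|` A `<=` B.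
  move=> x Mx; exists (vabs x), 0; split=> //; first exact: ideal_abs.
  by rewrite scale0r addr0 vlexx.
have Bu : B u.
  by exists 0, 1; split=> //; [case: iA|rewrite add0r scale1r vlexx].
apply: (maxA B).
  split; first by move=> x Ax; apply: AB; right.
  by move=> BA; apply: Mu; right; exact: BA.
have MB : M0 `|` B = B by rewrite setUidr// => x M0x; apply: AB; left.
rewrite /P MB; split.
  split.
  - by apply: AB; case: iA.
  - move=> b x y [m [k [Mm k0 xm]]] [m' [k' [Mm' k0' ym]]].
    exists (`|b| *: m + m'), (`|b| * k + k'); split.
    + by apply: idealD => //; exact: idealZ.
    + by rewrite addr_ge0 ?mulr_ge0.
    + apply: vle_trans' (vabsD _ _) _.
      rewrite scalerDl addrACA vle_add// vabsZ -scalerA -scalerDr.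
      exact: vscale_le.
  - by move=> x y [m [k [Mm k0 ym]]] xy; exists m, k; split=> //; exact: vle_trans' ym.
move=> [m [k [Mm k0 em]]]; apply: nex; exists m, k; split=> //.
exact: vle_trans' (ler_vabs _) em.
Qed.

Section MaximalIdeal.
Context {e : V} {M : set V}.
Hypotheses (e0 : 0 <=| e) (maxM : avoids_maximally e M).

Let iM : is_ideal M. Proof. by case: maxM. Qed.
Let Me : ~ M e. Proof. by case: maxM. Qed.

Lemma maximal_ideal_unit r x : r *: e <=| x -> M x -> r <= 0.
Proof.
move=> rx Mx; rewrite leNgt; apply/negP => r0; apply: Me.
rewrite -(scale1r e) -(mulVf (lt0r_neq0 r0)) -scalerA; apply: idealZ => //.
by apply: ideal_le Mx _ rx => //; apply: vscale_ge0 => //; exact: ltW.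
Qed.

(** Otherwise $e\le m+ku$ and $e\le n+lv$ with $m,n\in M$. Taking the infimum of the two bounds
    places $e$ below a multiple of $u\wedge v$ plus an element of $M$. *)
Lemma maximal_ideal_prime u v : 0 <=| u -> 0 <=| v -> M (u \wedge v) ->
  M u \/ M v.
Proof.
move=> u0 v0 Muv; apply: contrapT => /not_orP[Mu Mv].
have [_ _ maxM'] := maxM.
have [m [k [Mm k0]]] := maxM' _ Mu; have [n [l [Mn l0]]] := maxM' _ Mv.
rewrite !vabs_ge0_id// => en em.
pose p := vabs m + vabs n; pose c := k + l.
have Mp : M p by apply: idealD => //; exact: ideal_abs.
have : e <=| c *: (u \wedge v) + p.
  rewrite vscale_min ?addr_ge0// vminDr vle_min.
  apply/andP; split; [apply: vle_trans' em _|apply: vle_trans' en _]; rewrite addrC.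
    apply: vle_add; first by apply: vscale_lel => //; rewrite lerDl.
    by apply: vle_trans' (ler_vabs _) _; rewrite vle_addr ?vabs_ge0.
  apply: vle_add; first by apply: vscale_lel => //; rewrite lerDr.
  by apply: vle_trans' (ler_vabs _) _; rewrite /p addrC vle_addr ?vabs_ge0.
rewrite -{1}[e]scale1r => /maximal_ideal_unit h.
by have /h : M (c *: (u \wedge v) + p) by [apply: idealD => //; exact: idealZ]; rewrite ler10.
Qed.

(** Modulo [M] the principal ideal is totally ordered by primeness, so [x] defines a Dedekind cut
    among the multiples of [e]; its supremum is the required scalar. *)
Lemma maximal_ideal_value x : dominated e x -> exists r, M (x - r *: e).
Proof.
move=> /(dominated_pos e0)[c c0]; rewrite vabs_le => /andP[xc xNc].
pose S := [set r | M (vpos (r *: e - x))].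
have posM y : y <=| 0 -> M (vpos y) by move=> /vpos_eq0 ->; case: iM.
have S0 : S (- c) by apply: posM; rewrite scaleNr vle_subLR add0r vle_oppl.
have Sub : ubound S c.
  move=> r Sr; rewrite -subr_le0; apply: maximal_ideal_unit Sr.
  by rewrite scalerBl; apply: vle_trans' (vpos_ge _); rewrite vle_add2lE vle_opp2.
have supS : has_sup S by split; [exists (- c)|exists c].
have below d : 0 < d -> M (vpos ((sup S - d) *: e - x)).
  move=> d0; have [r Sr rd] := sup_adherent d0 supS.
  apply: ideal_le Sr (vpos_ge0 _) _ => //.
  rewrite vmax_le vpos_ge0 andbT; apply: vle_trans' (vpos_ge _).
  by rewrite vle_add2rE vscale_lel// ltW.
have above d : 0 < d -> M (vpos (x - (sup S + d) *: e)).
  move=> d0; have [||||//] := @maximal_ideal_prime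
    (vpos ((sup S + d) *: e - x)) (vpos (- ((sup S + d) *: e - x))).
  - exact: vpos_ge0.
  - exact: vpos_ge0.
  - by rewrite vpos_disj; case: iM.
  - move=> Md; have : sup S + d <= sup S by apply: ub_le_sup => //; exists c.
    by rewrite gerDl leNgt d0.
  - by rewrite opprB.
exists (sup S); apply: contrapT => Mx; have [_ _ maxM'] := maxM.
have [m [k [Mm k0 em]]] := maxM' _ Mx.
(* Chosen so that [k * d < 1]: absorbing [k * d] times [e] on the left leaves a positive multiple of
   [e] below an element of [M]. *)
pose d := (2 * (k + 1))^-1.
have d0 : 0 < d by rewrite invr_gt0 mulr_gt0// ltr_wpDl.
pose q := vpos ((sup S - d) *: e - x) + vpos (x - (sup S + d) *: e).
have Mq : M q by apply: idealD => //; [exact: below|exact: above].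
have xq : vabs (x - sup S *: e) <=| d *: e + q.
  apply: vabs_bound.
    apply: (@vle_trans' _ _ (d *: e + vpos (x - (sup S + d) *: e))).
      rewrite [d *: e + _]addrC -vle_subLR -addrA -opprD -scalerDl; exact: vpos_ge.
    by rewrite vle_add2lE vle_addl ?vpos_ge0.
  apply: (@vle_trans' _ _ (d *: e + vpos ((sup S - d) *: e - x))).
    by rewrite [d *: e + _]addrC -vle_subLR opprB addrAC -scalerBl; exact: vpos_ge.
  by rewrite vle_add2lE vle_addr ?vpos_ge0.
have : (1 - k * d) *: e <=| m + k *: q.
  rewrite scalerBl scale1r vle_subLR -addrA [_ + (k * d) *: _]addrC -scalerA -scalerDr.
  by apply: vle_trans' em _; rewrite vle_add2lE vscale_le.
move=> /maximal_ideal_unit h.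
have /h : M (m + k *: q) by [apply: idealD => //; exact: idealZ].
rewrite subr_le0 leNgt => /negP; apply.
by rewrite ltr_pdivrMr ?mulr_gt0 ?ltr_wpDl//; lra.
Qed.

End MaximalIdeal.
End Ideals.

Section BanachLatticeComplements.
Context {R : realType} {E : banachLatticeType R}.
Implicit Types (x y z e : E).

Lemma norm_vabs x : `|vabs x| = `|x| :> R.
Proof. by apply/eqP; rewrite eq_le !ler_vnorm// vabs_id vlexx. Qed.

Lemma ler_vnorm_pos x y : vabs x <=| y -> `|x| <= `|y| :> R.
Proof.
by move=> xy; apply: ler_vnorm; apply: vle_trans' xy _; exact: ler_vabs.
Qed.

(** The lattice norm is monotone, so $\|x^+\|\le d\|y\|$ for every $d>0$. *)
Lemma archimedean_le0 x y : (forall d : R, 0 < d -> x <=| d *: y) -> x <=| 0.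
Proof.
move=> xy; apply/vpos_eq0/normr0_eq0/le_anti; rewrite normr_ge0 andbT.
apply/ler_addgt0Pr => d d0; rewrite add0r.
have y0 : 0 < `|y| + 1 :> R by rewrite ltr_wpDl.
have /xy {}xy : 0 < d / (`|y| + 1) by rewrite divr_gt0.
apply: (@le_trans _ _ `|(d / (`|y| + 1)) *: vabs y|).
  apply: ler_vnorm_pos; rewrite vabs_ge0_id ?vpos_ge0//.
  rewrite vmax_le vscale_ge0 ?vabs_ge0 ?andbT ?ltW ?divr_gt0//.
  by apply: vle_trans' xy _; rewrite vscale_le ?ler_vabs// ltW ?divr_gt0.
rewrite normrZ norm_vabs gtr0_norm ?divr_gt0// mulrAC ler_pdivrMr//.
by apply: ler_wpM2l; [exact: ltW|rewrite lerDl].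
Qed.

End BanachLatticeComplements.

Section LatticeHomomorphisms.
Context {R : realType} {V : vectorLatticeType R}.
Implicit Types (x y z u v e : V) (a b : R) (w : V -> R).

(* The values of w outside the principal ideal generated by e are irrelevant.  *)
Definition lattice_hom e w : Prop :=
  (forall a x y, dominated e x -> dominated e y ->
    w (a *: x + y) = a * w x + w y) /\
  (forall x y, dominated e x -> dominated e y ->
    w (x \vee y) = Num.max (w x) (w y)).

Definition character e w : Prop := lattice_hom e w /\ w e = 1.

Section Dominated.
Variable e : V.
Hypothesis e0 : 0 <=| e.
Let dI := dominated_ideal e0.

Lemma dominated0 : dominated e 0. Proof. by case: dI. Qed.

Lemma dominated_self : dominated e e.
Proof. by exists 1; rewrite scale1r vabs_ge0_id// vlexx. Qed.

Lemma dominatedD x y : dominated e x -> dominated e y -> dominated e (x + y).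
Proof. exact: idealD. Qed.

Lemma dominatedZ a x : dominated e x -> dominated e (a *: x).
Proof. exact: idealZ. Qed.

Lemma dominatedN x : dominated e x -> dominated e (- x).
Proof. exact: idealN. Qed.

Lemma dominated_max x y : dominated e x -> dominated e y ->
  dominated e (x \vee y).
Proof.
move=> dx dy; apply: (ideal_sandwich dI dx (z := vabs x + vabs y)).
- by apply: dominatedD; exact: ideal_abs.
- exact: vmaxl.
- rewrite vmax_le; apply/andP; split.
    by apply: vle_trans' (ler_vabs _) _; rewrite vle_addr ?vabs_ge0.
  by apply: vle_trans' (ler_vabs _) _; rewrite vle_addl ?vabs_ge0.
Qed.

Lemma dominated_min x y : dominated e x -> dominated e y ->
  dominated e (x \wedge y).
Proof.
by move=> dx dy; rewrite vminE; apply/dominatedN/dominated_max; exact: dominatedN.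
Qed.

Lemma dominated_vabs x : dominated e x -> dominated e (vabs x).
Proof. exact: ideal_abs. Qed.

Lemma dominated_trans x y : dominated e x -> dominated x y -> dominated e y.
Proof.
move=> [c xc] [d yd]; exists (`|d| * c); apply: vle_trans' yd _.
rewrite -scalerA; apply: vle_trans' (ler_vabs _) _.
by rewrite vabsZ vscale_le.
Qed.

Variable w : V -> R.
Hypothesis hw : lattice_hom e w.

Lemma lhom0 : w 0 = 0.
Proof.
have := hw.1 1 _ _ dominated0 dominated0.
by rewrite scaler0 addr0 mul1r => /eqP; rewrite -subr_eq0 opprD addNKr oppr_eq0 => /eqP.
Qed.

Lemma lhomZ a x : dominated e x -> w (a *: x) = a * w x.
Proof. by move=> dx; have := hw.1 a _ _ dx dominated0; rewrite lhom0 !addr0. Qed.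

Lemma lhomD x y : dominated e x -> dominated e y -> w (x + y) = w x + w y.
Proof. by move=> dx dy; have := hw.1 1 _ _ dx dy; rewrite scale1r mul1r. Qed.

Lemma lhomN x : dominated e x -> w (- x) = - w x.
Proof. by move=> dx; rewrite -scaleN1r lhomZ// mulN1r. Qed.

Lemma lhomB x y : dominated e x -> dominated e y -> w (x - y) = w x - w y.
Proof. by move=> dx dy; rewrite lhomD ?lhomN//; exact: dominatedN. Qed.

Lemma lhom_max x y : dominated e x -> dominated e y ->
  w (x \vee y) = Num.max (w x) (w y).
Proof. exact: hw.2. Qed.

Lemma lhom_min x y : dominated e x -> dominated e y ->
  w (x \wedge y) = Num.min (w x) (w y).
Proof.
move=> dx dy; rewrite vminE lhomN ?lhom_max ?lhomN ?oppr_max ?opprK//.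
- exact: dominatedN.
- exact: dominatedN.
- by apply: dominated_max; exact: dominatedN.
Qed.

Lemma lhom_abs x : dominated e x -> w (vabs x) = `|w x|.
Proof.
move=> dx; rewrite lhom_max ?lhomN//; last exact: dominatedN.
by case: leP => h; [rewrite ler0_norm|rewrite ger0_norm]; lra.
Qed.

Lemma lhom_le x y : dominated e x -> dominated e y -> x <=| y -> w x <= w y.
Proof.
move=> dx dy /vmax_eqr xy; have := lhom_max dx dy.
by rewrite xy => ->; rewrite le_max lexx.
Qed.

End Dominated.

Lemma lattice_hom_sub e e' w : 0 <=| e' -> dominated e' e -> lattice_hom e' w ->
  lattice_hom e w.
Proof.
move=> e0 de [wl wm]; split=> [a x y dx dy|x y dx dy].
  by apply: wl; exact: dominated_trans de _.
by apply: wm; exact: dominated_trans de _.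
Qed.

(** The scalar [w x] with [x - w x *: e] in [M] is unique, which gives linearity; solidity of [M]
    and the Lipschitz bound for suprema give compatibility with [\vee]. *)
Lemma maximal_ideal_character e M : 0 <=| e -> avoids_maximally e M ->
  exists w, character e w /\ forall x, dominated e x -> M (x - w x *: e).
Proof.
move=> e0 maxM; have iM : is_ideal M by case: maxM.
pose w x := xget 0 [set r | M (x - r *: e)].
have wM x : dominated e x -> M (x - w x *: e).
  by move=> /(maximal_ideal_value e0 maxM); exact: xgetPex.
have uniq x r : dominated e x -> M (x - r *: e) -> w x = r.
  move=> /wM Mw Mr; have D s t : M (x - s *: e) -> M (x - t *: e) -> s <= t.
    move=> Ms Mt; rewrite -subr_le0.
    apply: (maximal_ideal_unit e0 maxM (x := (x - t *: e) - (x - s *: e))).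
      by rewrite scalerBl [X in _ <=| X]addrC opprB addrA subrK vlexx.
    by apply: idealD => //; exact: idealN.
  by apply/le_anti; rewrite !D.
exists w; split=> //; split; last first.
  apply: uniq; first exact: dominated_self.
  by rewrite scale1r subrr; case: iM.
split=> [a x y dx dy|x y dx dy].
  apply: uniq; first by apply: dominatedD => //; exact: dominatedZ.
  have -> : a *: x + y - (a * w x + w y) *: e =
      a *: (x - w x *: e) + (y - w y *: e).
    by rewrite scalerBr scalerDl opprD addrACA scalerA.
  by apply: idealD; [|apply: idealZ|]; rewrite ?wM//; exact: wM.
apply: uniq; first exact: dominated_max.
have -> : Num.max (w x) (w y) *: e = (w x *: e) \vee (w y *: e).
  case: leP => [xy|/ltW yx]; first by rewrite vmax_eqr// vscale_lel.
  by rewrite vmaxC vmax_eqr// vscale_lel.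
have [_ _ sM] := iM.
apply: (sM _ (vabs (x - w x *: e) + vabs (y - w y *: e))).
  by apply: idealD => //; apply: ideal_abs => //; exact: wM.
by apply: vle_trans' (vabs_maxB2 _ _ _ _) _; exact: ler_vabs.
Qed.

End LatticeHomomorphisms.

Create HintDb dominated.
#[export] Hint Resolve dominated0 dominated_self dominatedD dominatedZ dominatedN
  dominated_max dominated_min dominated_vabs : dominated.

Section Separation.
Context {R : realType} {E : banachLatticeType R}.
Implicit Types (x y z e : E) (w : E -> R).

(* With d > 0 such that (z^- - d e)^+ <> 0, a maximal ideal containing         *)
(* (z^- - d e)^- yields a character with w (z^-) >= d.                         *)
Lemma character_ge0 e z : 0 <=| e -> dominated e z ->
  (forall w, character e w -> 0 <= w z) -> 0 <=| z.
Proof.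
move=> e0 dz wz; apply: contrapT => z0.
pose y := vpos (- z).
have [c c0 zc] := dominated_pos e0 dz.
have dy : dominated e y by apply: dominated_max; auto with dominated.
have [d d0 yd] : exists2 d : R, 0 < d & ~ (y <=| d *: e).
  apply: contrapT => nd; apply: z0; rewrite -vle_opp2 oppr0.
  apply: vle_trans' (vpos_ge _) _; apply: (@archimedean_le0 _ _ _ e) => d d0.
  by apply: contrapT => yd; apply: nd; exists d.
pose n := vpos (- (y - d *: e)).
have dn : dominated e n by rewrite /n /vpos; auto 10 with dominated.
have n0 : 0 <=| n by exact: vpos_ge0.
(* If $e\le kn$, then $(y-de)^+\le ce\le ckn$ while $(y-de)^+\perp n$. Hence $(y-de)^+=0$, against
   the choice of $d$. *)
have ne : ~ dominated n e.
  move=> /(dominated_pos n0)[k k0]; rewrite vabs_ge0_id// => ek.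
  have vd : vpos (y - d *: e) <=| c *: e.
    rewrite vmax_le vscale_ge0 ?ltW// andbT vle_subLR.
    apply: (@vle_trans' _ _ (c *: e)).
      rewrite vmax_le vscale_ge0 ?ltW// andbT.
      by apply: vle_trans' zc; exact: lerN_vabs.
    by rewrite vle_addr ?vscale_ge0// ltW.
  have : vpos (y - d *: e) <=| 0.
    have ck : 0 <= c * k + 1 by rewrite addr_ge0 ?mulr_ge0 ?ltW.
    rewrite -(scaler0 _ (c * k + 1)) -(vpos_disj (y - d *: e)).
    apply: vle_trans' (vmin_scale_le _ (vpos_ge0 _) _).
      rewrite vle_min vlexx /=; apply: vle_trans' vd _.
      apply: (@vle_trans' _ _ ((c * k) *: n)).
        by rewrite -scalerA vscale_le// ltW.
      by rewrite vscale_lel// lerDl.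
    by rewrite lerDr mulr_ge0 ?ltW.
  move=> /(vle_trans' (vpos_ge _)); rewrite vle_subLR add0r; exact: yd.
have [M [nM maxM]] := ideal_avoiding (dominated_ideal n0) ne.
have [w [cw wM]] := maximal_ideal_character e0 maxM.
have hw := cw.1.
have iM : is_ideal M by case: maxM.
have wn : w n = 0.
  have MMn : M (w n *: e).
    rewrite -(subKr n (w n *: e)); apply: idealD => //.
      by apply: nM; exact: dominated_self.
    by apply: idealN => //; exact: wM.
  apply/le_anti/andP; split; first exact: (maximal_ideal_unit e0 maxM (vlexx _) MMn).
  rewrite -(lhom0 e0 hw); apply: (lhom_le hw) => //; exact: dominated0.
have := wz w cw.
rewrite leNgt => /negP; apply.
move: wn; rewrite /n /vpos (lhom_max hw); auto 10 with dominated.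
rewrite opprB (lhomB e0 hw) ?(lhomZ e0 hw) ?(lhom0 e0 hw); auto 10 with dominated.
rewrite cw.2 mulr1 /y /vpos (lhom_max hw) ?(lhomN e0 hw) ?(lhom0 e0 hw);
  auto with dominated.
by case: (leP (- w z) 0) => ?; [case: (leP (d - 0))|case: (leP (d - - w z))] => ? ?; lra.
Qed.

Lemma character_le e x y : 0 <=| e -> dominated e x -> dominated e y ->
  (forall w, character e w -> w x <= w y) -> x <=| y.
Proof.
move=> e0 dx dy xy; rewrite -vle_sub; apply: (character_ge0 e0) => [|w cw].
  by auto with dominated.
by rewrite (lhomB e0 cw.1)// subr_ge0 xy.
Qed.

Lemma character_eq e x y : 0 <=| e -> dominated e x -> dominated e y ->
  (forall w, character e w -> w x = w y) -> x = y.
Proof.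
move=> e0 dx dy xy; apply: vle_eq; apply: (character_le e0) => // w cw;
by rewrite xy.
Qed.

End Separation.

(** * The lattice Stone-Weierstrass theorem for homogeneous functions *)

Section LatticeStoneWeierstrass.
Context {R : realType}.

Lemma continuous_lin (T : topologicalType) (a : R) (f g : T -> R) :
  continuous f -> continuous g -> continuous (fun t => a * f t + g t).
Proof.
move=> cf cg t; apply: cvgD; last exact: cg.
by apply: cvgM; [exact: cvg_cst|exact: cf].
Qed.

Lemma continuous_affine (T : topologicalType) (a b : R) (f : T -> R) :
  continuous f -> continuous (fun t => a * f t + b).
Proof. by move=> cf; apply: continuous_lin => // t; exact: cvg_cst. Qed.

(** A strict inequality at one point persists on a neighbourhood, and the maximum over a finite
    subcover works on all of [K]. *)
Lemma compact_majorant (T : ptopologicalType) (K : set T) (f : T -> R)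
    (Q : set (T -> R)) :
  compact K -> continuous f -> Q `<=` [set g | continuous g] ->
  (forall g h, Q g -> Q h -> Q (fun t => Num.max (g t) (h t))) ->
  K !=set0 -> (forall t, K t -> exists2 g, Q g & f t < g t) ->
  exists2 g, Q g & forall t, K t -> f t < g t.
Proof.
rewrite compact_cover => cK cf cQ Qmax [t0 Kt0] Qf.
have [g0 Qg0 _] := Qf _ Kt0.
have [G GP] : exists G : T -> T -> R, forall t, K t -> Q (G t) /\ f t < G t t.
  have /choice[G GP] : forall t, exists g : T -> R, K t -> Q g /\ f t < g t.
    by move=> t; have [/Qf[g]|Kt] := pselect (K t); [exists g|exists g0 => /Kt].
  by exists G.
have [|t Kt|D' DK KD'] := cK T K (fun t => [set u | f u < G t u]).
- move=> t /GP[/cQ cG _].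
  rewrite (_ : [set _ | _] = (fun u => G t u - f u) @^-1` [set x | 0 < x]).
    apply: open_comp; last exact: open_gt.
    by move=> u _; apply: cvgB; [exact: cG|exact: cf].
  by apply/seteqP; split=> u /=; rewrite subr_gt0.
- by exists t => //; exact: (GP _ Kt).2.
have [g Qg gP] : exists2 g, Q g & forall t, t \in enum_fset D' ->
    forall u, f u < G t u -> f u < g u.
  have : {subset enum_fset D' <= K} by move=> t /DK.
  elim: (enum_fset D') => [|t s IHs] sK; first by exists g0.
  have [|g Qg gP] := IHs; first by move=> u us; apply: sK; rewrite in_cons us orbT.
  have /GP[Gt _] : K t by apply/set_mem/sK; rewrite mem_head.
  exists (fun u => Num.max (G t u) (g u)); first exact: Qmax.
  move=> u; rewrite in_cons => /orP[/eqP -> v fv|us v fv]; rewrite lt_max.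
    by rewrite fv.
  by rewrite (gP _ us _ fv) orbT.
by exists g => // t /KD'[u /= uD]; exact: gP.
Qed.

Lemma ord2P (i : 'I_2) : i = 0 \/ i = 1.
Proof. by case: i => -[|[|//]] ?; [left|right]; apply/val_inj. Qed.

Local Notation H := (@homogeneous_continuous R 2).

Lemma hc_coord i : H (fun t => t 0 i).
Proof.
by split=> [|a t _]; [exact: coord_continuous|rewrite mxE].
Qed.

Lemma hc_lin a f g : H f -> H g -> H (fun t => a * f t + g t).
Proof.
move=> [cf hf] [cg hg]; split=> [|b t b0]; first exact: continuous_lin.
by rewrite hf// hg// mulrDr mulrCA.
Qed.

Lemma hc_max f g : H f -> H g -> H (fun t => Num.max (f t) (g t)).
Proof.
move=> [cf hf] [cg hg]; split=> [t|b t b0].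
  by apply: continuous_max; [exact: cf|exact: cg].
by rewrite hf// hg// maxr_pMr.
Qed.

(** The sup norm is a lattice expression in the coordinates, so lattice homomorphisms can be moved
    through it ([norm_joint_value]). *)
Lemma norm_rV2 (t : 'rV[R]_2) :
  `|t| = Num.max (Num.max (t 0 0) (- t 0 0)) (Num.max (t 0 1) (- t 0 1)).
Proof.
have maxN (a : R) : Num.max a (- a) = `|a|.
  by case: leP => h; [rewrite ler0_norm|rewrite ger0_norm]; lra.
rewrite !maxN /Num.norm /= mx_normrE; apply/le_anti/andP; split.
  apply/bigmax_leP; split=> [|[i j] _] /=; first by rewrite le_max normr_ge0.
  rewrite ord1; have [->|->] := ord2P j.
  by rewrite le_max lexx.
  by rewrite le_max lexx orbT.
rewrite ge_max; apply/andP; split; apply/bigmax_geP; right.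
  by exists (0, 0).
by exists (0, 1).
Qed.

(* Both the interpolation of f at two points and the final estimate only need  *)
(* homogeneity, so that antipodal points of the sphere are no exception.       *)
Lemma homogeneous_lattice_dense (Q : set ('rV[R]_2 -> R)) :
  Q `<=` H ->
  (forall i, Q (fun t => t 0 i)) ->
  (forall a f g, Q f -> Q g -> Q (fun t => a * f t + g t)) ->
  (forall f g, Q f -> Q g -> Q (fun t => Num.max (f t) (g t))) ->
  (forall f, H f -> (forall e, 0 < e ->
    exists2 g, Q g & forall t, `|f t - g t| <= e * `|t|) -> Q f) ->
  H `<=` Q.
Proof.
move=> QH Qcoord Qlin Qmax Qlim f Hf; have [cf hf] := Hf.
apply: Qlim => // e e0.
have Q0 : Q (fun=> 0).
  have := Qlin (-1) _ _ (Qcoord 0) (Qcoord 0); congr Q.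
  by apply/funext => t; rewrite mulN1r addNr.
have Qscale a g : Q g -> Q (fun t => a * g t).
  move=> Qg; have := Qlin a _ _ Qg Q0; congr Q.
  by apply/funext => t; rewrite addr0.
have Qmin g h : Q g -> Q h -> Q (fun t => Num.min (g t) (h t)).
  move=> Qg Qh; have := Qscale (-1) _ (Qmax _ _ (Qscale (-1) _ Qg) (Qscale (-1) _ Qh)).
  by congr Q; apply/funext => t; rewrite !mulN1r oppr_max !opprK.
have Qpair a b : Q (fun t => a * t 0 0 + b * t 0 1).
  by apply: Qlin => //; exact: Qscale.
have interp (s t : 'rV[R]_2) : s != 0 -> exists g, [/\ Q g, g s = f s & g t = f t].
  move=> s0.
  pose D := s 0 0 * t 0 1 - s 0 1 * t 0 0.
  have [D0|D0] := eqVneq D 0; last first.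
    exists (fun u => (f s * t 0 1 - f t * s 0 1) / D * u 0 0
                     + (f t * s 0 0 - f s * t 0 0) / D * u 0 1); split=> //.
      by rewrite /D in D0 *; field.
    by rewrite /D in D0 *; field.
  (* Now [s] and [t] are parallel. The linear form [l] below, with [l s = 1], recovers [t] as
     [l t *: s]. *)
  pose n := s 0 0 ^+ 2 + s 0 1 ^+ 2.
  have n0 : n != 0.
    apply: contraNneq s0 => /eqP; rewrite paddr_eq0 ?sqr_ge0// !sqrf_eq0.
    move=> /andP[/eqP s00 /eqP s01]; apply/eqP/rowP => i; rewrite mxE.
    by have [->|->] := ord2P i.
  pose l (u : 'rV[R]_2) := s 0 0 / n * u 0 0 + s 0 1 / n * u 0 1.
  have ls : l s = 1 by rewrite /l /n in n0 *; field.
  have tE : t = l t *: s.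
    apply/rowP => i; rewrite !mxE /l.
    have [->|->] := ord2P i.
    - rewrite [LHS](_ : _ = (s 0 0 / n * t 0 0 + s 0 1 / n * t 0 1) * s 0 0 - s 0 1 * D / n).
        by rewrite D0 mulr0 mul0r subr0.
      by rewrite /n /D in n0 *; field.
    - rewrite [LHS](_ : _ = (s 0 0 / n * t 0 0 + s 0 1 / n * t 0 1) * s 0 1 + s 0 0 * D / n).
        by rewrite D0 mulr0 mul0r addr0.
      by rewrite /n /D in n0 *; field.
  (* A homogeneous function on the line through [s] is determined by its values at [s] and [- s],
     one for each half-line. *)
  exists (fun u => f s * Num.max (l u) 0 + f (- s) * Num.max (-1 * l u) 0).
  split.
  - have Ql : Q l by exact: Qpair.
    apply: (Qlin _ (fun u => Num.max (l u) 0) (fun u => f (- s) * Num.max (-1 * l u) 0)).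
      exact: (Qmax _ (fun=> 0)).
    apply: (Qscale _ (fun u => Num.max (-1 * l u) 0)).
    by apply: (Qmax (fun u => -1 * l u) (fun=> 0)) => //; exact: Qscale.
  - by rewrite ls; rewrite max_l// max_r ?mulr0 ?addr0 ?mulr1//; lra.
  - rewrite [in RHS]tE; have [lt0|lt0] := leP 0 (l t).
      by rewrite hf// max_r ?mulr0 ?addr0; [rewrite mulrC|lra].
    rewrite -[l t]opprK scaleNr -scalerN hf ?oppr_ge0 ?ltW//.
    rewrite mulr0 add0r max_l; [by rewrite mulrC; congr (_ * _); lra|lra].
pose K := [set t : 'rV[R]_2 | `|t| = 1].
have K0 t : K t -> t != 0 by move=> Kt; rewrite -normr_eq0 Kt oner_neq0.
have cK : compact K.
  apply: bounded_closed_compact.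
    by exists 1; split=> // x x1 t /= ->; exact: ltW.
  have -> : K = (fun t : 'rV[R]_2 => `|t|) @^-1` [set 1] by [].
  apply: closed_comp; last exact: closed_eq.
  by move=> t _; exact: norm_continuous.
have Kne : K !=set0.
  exists (const_mx 1) => /=; rewrite /K /= norm_rV2 !mxE.
  by rewrite maxxx max_l//; lra.
have step1 s : K s -> exists g, [/\ Q g, g s = f s & forall t, K t -> f t - e < g t].
  move=> Ks.
  have [|||||g [Qg gs] gf] := @compact_majorant _ K (fun t => f t - e)
      [set g | Q g /\ g s = f s] cK.
  - by under eq_fun do rewrite -[f _]mul1r; exact: continuous_affine.
  - by move=> g [/QH[]].
  - by move=> g h [Qg gs] [Qh hs]; split; [exact: Qmax|rewrite gs hs maxxx].
  - by [].
  - move=> t Kt; have [g [Qg gs gt]] := interp s t (K0 _ Ks).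
    by exists g => //; rewrite gt ltrBlDr ltrDl.
  - by exists g.
(* Passing to negatives turns majorants into minorants: a finite minimum of the functions from
   [step1] stays above [f - e] and falls below [f + e]. *)
have [|||||g [Qg gf1] gf2] := @compact_majorant _ K (fun t => - f t - e)
    [set g | Q (fun t => -1 * g t) /\ forall t, K t -> f t - e < -1 * g t] cK.
- by under eq_fun do rewrite -mulN1r; exact: continuous_affine.
- move=> g [/QH[cg _] _].
  have gE : (fun t => -1 * (-1 * g t) + 0) = g.
    by apply/funext => t; rewrite addr0 !mulN1r opprK.
  by move: (@continuous_affine _ (-1) 0 _ cg); rewrite gE.
- move=> g h [Qg gf] [Qh hf']; split.
    have := Qmin _ _ Qg Qh; congr Q; apply/funext => t.
    by rewrite !mulN1r oppr_max.
  move=> t Kt; have := gf _ Kt; have := hf' _ Kt.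
  by rewrite !mulN1r oppr_max lt_min => -> ->.
- by [].
- move=> t Kt; have [g [Qg gt gf]] := step1 _ Kt.
  exists (fun u => -1 * g u); last by rewrite gt; lra.
  split=> [|u Ku]; last by rewrite mulrA mulrNN !mulr1 mul1r; exact: gf.
  exact: (Qscale _ _ (Qscale _ _ Qg)).
exists (fun t => -1 * g t) => // t.
have [_ hg] := QH _ Qg.
have [->|t0] := eqVneq t 0.
  have z h : H h -> h 0 = 0 by move=> [_ /(_ 0 0 (lexx _))]; rewrite scale0r mul0r.
  by rewrite (z _ Hf) (z _ (QH _ Qg)) subrr !normr0 mulr0.
have nt : 0 < `|t| by rewrite normr_gt0.
pose u := `|t|^-1 *: t.
have Ku : K u by rewrite /K /= normrZ normrV ?unitfE ?gt_eqF// normr_id mulVf// gt_eqF.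
have -> : t = `|t| *: u by rewrite /u scalerA mulfV ?scale1r// gt_eqF.
rewrite hf// hg// -mulrBr normrM normr_id normrZ normr_id Ku mulr1 mulrC.
rewrite ler_wpM2r// ler_norml.
have := gf1 _ Ku; have := gf2 _ Ku; move: (f u) (g u) => x y ? ?.
by apply/andP; split; lra.
Qed.

End LatticeStoneWeierstrass.

(** * Functional calculus *)

Section OrderLimits.
Context {R : realType}.

Lemma natinv_lt (c d : R) : 0 < d ->
  exists N, forall n, (N <= n)%N -> c / n.+1%:R < d.
Proof.
move=> d0; have c1 : 0 < `|c| + 1 by rewrite ltr_wpDl.
have [|N] := @ltr_add_invr R 0 (d / (`|c| + 1)); first by rewrite divr_gt0.
rewrite add0r ltr_pdivlMr// mulrC => hN; exists N => n Nn.
apply: le_lt_trans hN; apply: (@le_trans _ _ ((`|c| + 1) / n.+1%:R)).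
  by rewrite ler_wpM2r// (le_trans (ler_norm c))// lerDl.
by rewrite ler_wpM2l ?(ltW c1)// lef_pV2 ?posrE// ler_nat.
Qed.

Lemma natinv_le0 (a c : R) : (forall n : nat, a <= c / n.+1%:R) -> a <= 0.
Proof.
move=> ac; apply/ler_addgt0Pr => d /(natinv_lt c)[N hN]; rewrite add0r.
by apply: le_trans (ac N) _; exact/ltW/hN.
Qed.

Lemma cauchy_seq_limit (V : completeNormedModType R) (c : R) (z : nat -> V) :
  (forall n m, (n <= m)%N -> `|z n - z m| <= c / n.+1%:R) ->
  exists l, forall d : R, 0 < d -> exists N, forall n, (N <= n)%N -> `|l - z n| < d.
Proof.
move=> zC; have cz : cvg (z @ \oo).
  apply/cauchy_cvgP/cauchy_exP => d /(natinv_lt c)[N hN]; exists (z N).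
  exists N => // n /= Nn; rewrite -ball_normE /=.
  by apply: le_lt_trans (zC _ _ Nn) _; exact: hN.
exists (lim (z @ \oo)) => d d0.
by have /cvgrPdist_lt/(_ _ d0)[N _ hN] := cz; exists N => n; exact: hN.
Qed.

Context {E : banachLatticeType R}.
Implicit Types (u v b z e : E).

Lemma norm_vpos_lip u v : `|vpos u - vpos v| <= `|u - v| :> R.
Proof. by apply: ler_vnorm; exact: vabs_maxB. Qed.

Lemma norm_vabs_lip u v : `|vabs u - vabs v| <= `|u - v| :> R.
Proof.
apply: ler_vnorm; apply: vabs_bound; first by
  rewrite vle_subLR; apply: vle_trans' (vabsD _ _); rewrite subrK vlexx.
rewrite opprB vle_subLR vabs_subC; apply: vle_trans' (vabsD _ _).
by rewrite subrK vlexx.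
Qed.

Lemma vle_closure u b :
  (forall d : R, 0 < d -> exists2 v, v <=| b & `|u - v| < d) -> u <=| b.
Proof.
move=> ub; rewrite -(vle_add2rE (- b)) subrr; apply/vpos_eq0/normr0_eq0/le_anti.
rewrite normr_ge0 andbT; apply/ler_addgt0Pr => d /ub[v vb uv]; rewrite add0r.
have := norm_vpos_lip (u - b) (v - b).
have -> : vpos (v - b) = 0 by apply/vpos_eq0; rewrite vle_subLR add0r.
by rewrite subr0 opprB addrA subrK => /le_trans; apply; exact: ltW.
Qed.

(** The limit exists in norm, and closed order intervals transfer the rate relative to [e]. That
    rate is what matters: homomorphisms on a principal ideal need not be norm continuous, but they
    respect bounds by multiples of [e]. *)
Lemma uniform_cauchy_limit e (z : nat -> E) :
  (forall n m, (n <= m)%N -> vabs (z n - z m) <=| (2 / n.+1%:R : R) *: e) ->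
  exists l, forall n, vabs (l - z n) <=| (2 / n.+1%:R : R) *: e.
Proof.
move=> zC; have [|l zl] := @cauchy_seq_limit E (2 * `|e|) z.
  move=> n m /zC/ler_vnorm_pos.
  by rewrite normrZ ger0_norm// mulrAC.
exists l => n; apply: vle_closure => d /zl[N hN].
exists (vabs (z (maxn N n) - z n)).
  by rewrite vabs_subC; apply: zC; rewrite leq_maxr.
apply: le_lt_trans (hN _ (leq_maxl N n)).
apply: le_trans (norm_vabs_lip _ _) _.
by rewrite opprB addrA subrK.
Qed.

End OrderLimits.

Section Calculus.
Context {R : realType} {E : banachLatticeType R}.
Implicit Types (x y z e : E) (X : 'I_2 -> E) (w : E -> R) (f g : 'rV[R]_2 -> R).

Local Notation H := (@homogeneous_continuous R 2).

Definition joint_value X w : 'rV[R]_2 := \row_i w (X i).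

Definition joint_bound X : E := vabs (X 0) \vee vabs (X 1).

Lemma joint_bound_ge0 X : 0 <=| joint_bound X.
Proof. exact: vle_trans' (vabs_ge0 (X 0)) (vmaxl _ _). Qed.

Lemma dominated_joint X i : dominated (joint_bound X) (X i).
Proof. by exists 1; rewrite scale1r; have [->|->] := ord2P i; rewrite ?vmaxl ?vmaxr. Qed.

Lemma norm_joint_value X w : lattice_hom (joint_bound X) w ->
  `|joint_value X w| = w (joint_bound X).
Proof.
move=> hw; have e0 := joint_bound_ge0 X; have dX := dominated_joint X.
rewrite norm_rV2 !mxE /joint_bound /vabs !(lhom_max hw) ?(lhomN e0 hw);
  by auto with dominated.
Qed.

(** By separation of points this pins [z] down as $f(x_1,x_2)$ without reference to a homomorphism
    [tau]. Unnormalised homomorphisms are allowed because [f] will be homogeneous. *)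
Definition calculus_value X f z : Prop :=
  dominated (joint_bound X) z /\
  forall w, lattice_hom (joint_bound X) w -> w z = f (joint_value X w).

Lemma calculus_value_lin X a f g x y :
  calculus_value X f x -> calculus_value X g y ->
  calculus_value X (fun t => a * f t + g t) (a *: x + y).
Proof.
have e0 := joint_bound_ge0 X.
move=> [dx xf] [dy yg]; split=> [|w hw]; first by auto with dominated.
by rewrite hw.1// xf// yg.
Qed.

Lemma calculus_value_max X f g x y :
  calculus_value X f x -> calculus_value X g y ->
  calculus_value X (fun t => Num.max (f t) (g t)) (x \vee y).
Proof.
have e0 := joint_bound_ge0 X.
move=> [dx xf] [dy yg]; split=> [|w hw]; first by auto with dominated.
by rewrite hw.2// xf// yg.
Qed.

Lemma calculus_value_min X f g x y :
  calculus_value X f x -> calculus_value X g y ->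
  calculus_value X (fun t => Num.min (f t) (g t)) (x \wedge y).
Proof.
have e0 := joint_bound_ge0 X.
move=> [dx xf] [dy yg]; split=> [|w hw]; first by auto with dominated.
by rewrite (lhom_min e0 hw)// xf// yg.
Qed.

Lemma calculus_value_coord X i : calculus_value X (fun t => t 0 i) (X i).
Proof. by split=> [|w hw]; [exact: dominated_joint|rewrite mxE]. Qed.

(** Since the norm of the joint value is [w (joint_bound X)], an error [d * |t|] between functions
    becomes an error [d] relative to the unit, and [uniform_cauchy_limit] applies. *)
Lemma calculus_value_lim X f :
  (forall d : R, 0 < d -> exists2 g, (exists z, calculus_value X g z) &
    forall t, `|f t - g t| <= d * `|t|) -> exists z, calculus_value X f z.
Proof.
move=> fg; pose e := joint_bound X; have e0 : 0 <=| e := joint_bound_ge0 X.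
have /choice[z zP] : forall n : nat, exists z, exists2 g, calculus_value X g z &
    forall t, `|f t - g t| <= n.+1%:R^-1 * `|t|.
  move=> n; have [|g [z zg] gf] := fg n.+1%:R^-1; first by rewrite invr_gt0.
  by exists z, g.
have dz n : dominated e (z n) by have [g []] := zP n.
have wz n w : lattice_hom e w -> `|f (joint_value X w) - w (z n)| <= n.+1%:R^-1 * w e.
  move=> hw; have [g [_ ->//] ] := zP n.
  by move=> /(_ (joint_value X w)); rewrite norm_joint_value.
have [|l lz] := @uniform_cauchy_limit _ _ e z.
  move=> n m nm; apply: (character_le e0); auto with dominated.
  move=> w [hw we].
  rewrite (lhom_abs e0 hw) ?(lhomB e0 hw) ?(lhomZ e0 hw); auto with dominated.
  have := wz n w hw; have := wz m w hw; rewrite we !mulr1 => fm fn.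
  rewrite -(subrKA (f (joint_value X w))); apply: le_trans (ler_normD _ _) _.
  rewrite distrC [2]mulr2n mulrDl mul1r lerD//; apply: le_trans fm _.
  by rewrite lef_pV2 ?posrE// ler_nat.
have dl : dominated e l.
  rewrite -(subrK (z 0%N) l); apply: dominatedD => //.
  by exists (2 / 1%:R).
exists l; split=> // w hw; apply/eqP; rewrite -subr_eq0 -normr_eq0.
apply/eqP/le_anti; rewrite normr_ge0 andbT.
apply: (@natinv_le0 _ _ (3 * w e)) => n.
rewrite -(subrKA (w (z n))); apply: le_trans (ler_normD _ _) _.
have -> : 3 * w e / n.+1%:R = 2 * w e / n.+1%:R + w e / n.+1%:R by ring.
rewrite lerD//.
  rewrite -(lhomB e0 hw)// -(lhom_abs e0 hw); last by auto with dominated.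
  rewrite mulrAC -(lhomZ e0 hw); last by auto with dominated.
  by apply: (lhom_le hw); auto with dominated.
by rewrite distrC mulrC wz.
Qed.

Lemma calculus_value_exists X f : H f -> exists z, calculus_value X f z.
Proof.
move=> Hf; have [] : H f /\ exists z, calculus_value X f z; last by [].
move: f Hf; apply: (@homogeneous_lattice_dense _
  [set f | H f /\ exists z, calculus_value X f z]).
- by move=> f [].
- move=> i; split; first exact: hc_coord.
  by exists (X i); exact: calculus_value_coord.
- move=> a f g [Hf [x fx]] [Hg [y gy]]; split; first exact: hc_lin.
  by exists (a *: x + y); exact: calculus_value_lin.
- move=> f g [Hf [x fx]] [Hg [y gy]]; split; first exact: hc_max.
  by exists (x \vee y); exact: calculus_value_max.
- move=> f Hf fg; split=> //; apply: calculus_value_lim => d /fg[g [_ gz] gf].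
  by exists g.
Qed.

Lemma calculus_value_unique X f x y :
  calculus_value X f x -> calculus_value X f y -> x = y.
Proof.
move=> [dx fx] [dy fy]; apply: (character_eq (joint_bound_ge0 X)) => // w [hw _].
by rewrite fx// fy.
Qed.

Lemma calculus_exists X : exists2 tau, is_calculus X tau &
  forall f, H f -> calculus_value X f (tau f).
Proof.
pose tau f := xget 0 [set z | calculus_value X f z].
have tauP f : H f -> calculus_value X f (tau f).
  by move=> /(calculus_value_exists X); exact: xgetPex.
have tauE f z : calculus_value X f z -> tau f = z.
  by move=> fz; apply: (calculus_value_unique _ fz); apply: xgetPex; exists z.
exists tau => //; split=> [a f g Hf Hg|f g Hf Hg|f g Hf Hg|i]; apply: tauE.
- by apply: calculus_value_lin; exact: tauP.
- by apply: calculus_value_max; exact: tauP.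
- by apply: calculus_value_min; exact: tauP.
- exact: calculus_value_coord.
Qed.

Lemma is_calculus_le X tau f g : is_calculus X tau -> H f -> H g ->
  (forall t, f t <= g t) -> tau f <=| tau g.
Proof.
move=> [_ tmax _ _] Hf Hg fg; have := tmax f g Hf Hg.
have -> : (fun t => Num.max (f t) (g t)) = g.
  by apply/funext => t; rewrite max_r.
by move=> ->; exact: vmaxl.
Qed.

Lemma hc_norm : H (fun t => `|t|).
Proof.
split=> [|a t a0]; first exact: norm_continuous.
by rewrite normrZ ger0_norm.
Qed.

Lemma is_calculus_unique X tau tau' f : is_calculus X tau -> is_calculus X tau' ->
  H f -> tau f = tau' f.
Proof.
move=> ct ct' Hf; have [_] : H f /\ tau f = tau' f; last by [].
have N := hc_norm.
move: f Hf; apply: (@homogeneous_lattice_dense _ [set f | H f /\ tau f = tau' f]).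
- by move=> f [].
- move=> i; split; first exact: hc_coord.
  by have [_ _ _ ->] := ct; have [_ _ _ ->] := ct'.
- move=> a f g [Hf ff] [Hg gg]; split; first exact: hc_lin.
  by have [-> // _ _ _] := ct; have [-> // _ _ _] := ct'; rewrite ff gg.
- move=> f g [Hf ff] [Hg gg]; split; first exact: hc_max.
  by have [_ -> // _ _] := ct; have [_ -> // _ _] := ct'; rewrite ff gg.
move=> f Hf fg; split=> //.
(* Comparing [f] with [g] within [d] times the norm function, at which both calculi are evaluated,
   bounds [s f - s' f] by [d] times a fixed element; the Archimedean property concludes. *)
have D (s s' : ('rV[R]_2 -> R) -> E) : is_calculus X s -> is_calculus X s' ->
    (forall d : R, 0 < d -> exists2 g, H g /\ s g = s' g &
      forall t, `|f t - g t| <= d * `|t|) -> s f <=| s' f.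
  move=> cs cs' sg; rewrite -(vle_add2rE (- s' f)) subrr.
  apply: (@archimedean_le0 _ _ _ (s (fun t => `|t|) + s' (fun t => `|t|))).
  move=> d /sg[g [Hg gg] gf].
  have [sl _ _ _] := cs; have [sl' _ _ _] := cs'.
  rewrite scalerDr vle_subLR -addrA.
  apply: (@vle_trans' _ _ (d *: s (fun t => `|t|) + s g)).
    rewrite -sl//; apply: (is_calculus_le cs) => //; first exact: hc_lin.
    by move=> t; have := gf t; rewrite ler_norml => /andP[_]; rewrite lerBlDr.
  rewrite vle_add2lE gg -sl'//; apply: (is_calculus_le cs') => //.
    exact: hc_lin.
  by move=> t; have := gf t; rewrite ler_norml => /andP[]; rewrite lerBrDr addrC lerBlDr addrC.
apply: vle_eq; apply: D => // d /fg[g [Hg gg] gf]; by exists g.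
Qed.

(** The form in which the functional calculus is used from here on: any common bound [e] serves, so
    several expressions can be evaluated at the same [w]. *)
Lemma calculusP X f e w : H f -> 0 <=| e -> (forall i, dominated e (X i)) ->
  dominated e (calculus X f) /\
  (lattice_hom e w -> w (calculus X f) = f (joint_value X w)).
Proof.
move=> Hf e0 dX; have [tau ct tauP] := calculus_exists X.
have -> : calculus X f = tau f.
  apply: xget_unique; first by exists tau.
  by move=> _ [tau' ct' ->]; exact: (is_calculus_unique ct').
have de : dominated e (joint_bound X).
  by apply: dominated_max; auto with dominated.
have [df fw] := tauP f Hf; split; first exact: dominated_trans df.
by move=> hw; apply: fw; exact: lattice_hom_sub hw.
Qed.

End Calculus.

(** * The 2-concavification *)

(** The signed square and signed root are mutually inverse increasing bijections of the reals, which
    translate the operations of $E_{(2)}$ into ordinary arithmetic. *)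
HB.lock Definition ssq {R : realType} (t : R) : R := spow t 2.
HB.lock Definition sroot {R : realType} (t : R) : R := spow t 2^-1.

HB.lock Definition gmean {R : realType} {E : banachLatticeType R} (x y : E) : E :=
  calculus (fun i : 'I_2 => if i == 0 then x else y)
    (fun t => sroot (t 0 0 * t 0 1)).

(* Locked, since unification should not unfold the calculus.                   *)
HB.lock Definition cvadd {R : realType} {E : banachLatticeType R} (x y : E) : E :=
  cv_add x y.

Section SignedPowers.
Context {R : realType}.
Implicit Types (a b s t : R).

Lemma ssqE t : ssq t = t * `|t|.
Proof.
by rewrite ssq.unlock /spow powR_mulrn// expr2 mulrA -numEsg.
Qed.

Lemma srootE t : sroot t = Num.sg t * Num.sqrt `|t|.
Proof. by rewrite sroot.unlock /spow powR12_sqrt. Qed.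

Lemma ssq_ge0 t : 0 <= t -> ssq t = t ^+ 2.
Proof. by move=> t0; rewrite ssqE ger0_norm. Qed.

Lemma ssqN t : ssq (- t) = - ssq t.
Proof. by rewrite !ssqE normrN mulNr. Qed.

Lemma ssqM s t : ssq (s * t) = ssq s * ssq t.
Proof. by rewrite !ssqE normrM mulrACA. Qed.

Lemma srootM s t : sroot (s * t) = sroot s * sroot t.
Proof. by rewrite !srootE normrM sqrtrM// sgrM mulrACA. Qed.

Lemma sroot_ge0 t : 0 <= t -> sroot t = Num.sqrt t.
Proof.
rewrite le_eqVlt srootE => /predU1P[<-|t0]; first by rewrite sgr0 mul0r sqrtr0.
by rewrite gtr0_sg// mul1r gtr0_norm.
Qed.

Lemma srootN t : sroot (- t) = - sroot t.
Proof. by rewrite !srootE normrN sgrN mulNr. Qed.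

Lemma sroot_abs t : `|sroot t| = sroot `|t|.
Proof.
have [t0|t0] := leP 0 t; first by rewrite !ger0_norm// sroot_ge0// sqrtr_ge0.
rewrite (ltr0_norm t0) -{1}(opprK t) srootN normrN ger0_norm//.
by rewrite sroot_ge0 ?sqrtr_ge0// oppr_ge0 ltW.
Qed.

Lemma sroot0 : sroot (0 : R) = 0. Proof. by rewrite srootE sgr0 mul0r. Qed.
Lemma sroot1 : sroot (1 : R) = 1. Proof. by rewrite sroot_ge0// sqrtr1. Qed.
Lemma ssq0 : ssq (0 : R) = 0. Proof. by rewrite ssqE mul0r. Qed.

Lemma ssqK : cancel (@ssq R) sroot.
Proof.
have K t : 0 <= t -> sroot (ssq t) = t.
  by move=> t0; rewrite ssq_ge0// sroot_ge0 ?sqr_ge0// sqrtr_sqr ger0_norm.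
move=> t; have [/K//|t0] := leP 0 t.
by rewrite -[t]opprK ssqN srootN K// oppr_ge0 ltW.
Qed.

Lemma srootK : cancel (@sroot R) ssq.
Proof.
have K t : 0 <= t -> ssq (sroot t) = t.
  by move=> t0; rewrite sroot_ge0// ssq_ge0 ?sqrtr_ge0// sqr_sqrtr.
move=> t; have [/K//|t0] := leP 0 t.
by rewrite -[t]opprK srootN ssqN K// oppr_ge0 ltW.
Qed.

Lemma ssq_le s t : s <= t -> ssq s <= ssq t.
Proof.
rewrite !ssqE => st; have [s0|s0] := leP 0 s; have [t0|t0] := leP 0 t.
- by rewrite !ger0_norm//; nra.
- by lra.
- by rewrite ltr0_norm// ger0_norm//; nra.
- by rewrite !ltr0_norm//; nra.
Qed.

Lemma sroot_le s t : s <= t -> sroot s <= sroot t.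
Proof.
move=> st; rewrite leNgt; apply/negP => ts; move: st; rewrite leNgt => /negP; apply.
rewrite -(srootK t) -(srootK s) lt_neqAle ssq_le ?(ltW ts)// andbT.
by apply: contraTneq ts => /(can_inj ssqK) ->; rewrite ltxx.
Qed.

Lemma continuous_ssq : continuous (@ssq R).
Proof.
rewrite (_ : @ssq R = (fun t => t * `|t|)); last by apply/funext => t; rewrite ssqE.
by move=> t; apply: cvgM => //; exact: norm_continuous.
Qed.

Lemma continuous_sroot : continuous (@sroot R).
Proof.
have -> : @sroot R = (fun t => Num.sqrt t - Num.sqrt (- t)).
  apply/funext => t; have [t0|t0] := leP 0 t.
    by rewrite sroot_ge0// [Num.sqrt (- t)]ler0_sqrtr ?subr0// oppr_le0.
  by rewrite -{1}[t]opprK srootN sroot_ge0 ?oppr_ge0 ?ltW// [Num.sqrt t]ler0_sqrtr ?sub0r ?ltW.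
move=> t; apply: cvgB; first exact: sqrt_continuous.
by apply: (@continuous_comp _ _ _ -%R); [exact: opp_continuous|exact: sqrt_continuous].
Qed.

Lemma hc_cv_add : homogeneous_continuous
  (fun t : 'rV[R]_2 => sroot (ssq (t 0 0) + ssq (t 0 1))).
Proof.
split=> [|a t a0]; last first.
  rewrite !mxE !ssqM -mulrDr [LHS]srootM; congr (_ * _).
  exact: ssqK.
move=> t; apply: (@continuous_comp _ _ _ (fun t : 'rV[R]_2 => ssq (t 0 0) + ssq (t 0 1)));
  last exact: continuous_sroot.
have c i : continuous (fun t : 'rV[R]_2 => ssq (t 0 i)).
  move=> u; apply: (@continuous_comp _ _ _ (fun t : 'rV[R]_2 => t 0 i)).
    exact: coord_continuous.
  exact: continuous_ssq.
have := @continuous_lin _ _ 1 _ _ (c 0) (c 1).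
by under eq_fun do rewrite mul1r; apply.
Qed.

Lemma hc_gmean : homogeneous_continuous (fun t : 'rV[R]_2 => sroot (t 0 0 * t 0 1)).
Proof.
split=> [|a t a0]; last first.
  rewrite !mxE mulrACA [LHS]srootM; congr (_ * _).
  by rewrite sroot_ge0 ?mulr_ge0// -expr2 sqrtr_sqr ger0_norm.
move=> t; apply: (@continuous_comp _ _ _ (fun t : 'rV[R]_2 => t 0 0 * t 0 1));
  last exact: continuous_sroot.
by apply: (@continuousM _ _ (fun t : 'rV[R]_2 => t 0 0) (fun t : 'rV[R]_2 => t 0 1));
  exact: coord_continuous.
Qed.

End SignedPowers.

Section ConcavificationOperations.
Context {R : realType} {E : banachLatticeType R}.
Implicit Types (x y z e : E) (w : E -> R) (a b : R).

Lemma cv_addE x y : cv_add x y =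
  calculus (fun i : 'I_2 => if i == 0 then x else y)
    (fun t => sroot (ssq (t 0 0) + ssq (t 0 1))).
Proof. by rewrite sroot.unlock ssq.unlock. Qed.

Lemma cv_scaleE a x : cv_scale a x = sroot a *: x.
Proof. by rewrite sroot.unlock. Qed.

Lemma common_bound x y z :
  exists e, [/\ 0 <=| e, dominated e x, dominated e y & dominated e z].
Proof.
exists (vabs x + vabs y + vabs z).
split; first by do 2?apply: vle_add0; exact: vabs_ge0.
- exists 1; rewrite scale1r -addrA vle_addr// vle_add0//; exact: vabs_ge0.
- exists 1; rewrite scale1r addrAC; apply: vle_addl; apply: vle_add0; exact: vabs_ge0.
- exists 1; rewrite scale1r; apply: vle_addl; apply: vle_add0; exact: vabs_ge0.
Qed.

Section Values.
Variables (e : E) (w : E -> R).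
Hypotheses (e0 : 0 <=| e).

Lemma dominated_cvadd x y : dominated e x -> dominated e y ->
  dominated e (cvadd x y).
Proof.
move=> dx dy; rewrite cvadd.unlock cv_addE.
apply: (@calculusP _ _ _ _ e (fun=> 0) hc_cv_add e0 _).1 => i.
by case: ifP.
Qed.

Lemma dominated_gmean x y : dominated e x -> dominated e y ->
  dominated e (gmean x y).
Proof.
move=> dx dy; rewrite gmean.unlock; apply: (@calculusP _ _ _ _ e (fun=> 0) hc_gmean e0 _).1 => i.
by case: ifP.
Qed.

Lemma dominated_cv_scale a x : dominated e x -> dominated e (cv_scale a x).
Proof. exact: dominatedZ. Qed.

Hypothesis hw : lattice_hom e w.

Lemma lhom_cvadd x y : dominated e x -> dominated e y ->
  w (cvadd x y) = sroot (ssq (w x) + ssq (w y)).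
Proof.
move=> dx dy; rewrite cvadd.unlock cv_addE.
rewrite [LHS](@calculusP _ _ _ _ e w hc_cv_add e0 _).2 ?mxE// => i.
by case: ifP.
Qed.

Lemma lhom_gmean x y : dominated e x -> dominated e y ->
  w (gmean x y) = sroot (w x * w y).
Proof.
move=> dx dy; rewrite gmean.unlock [LHS](@calculusP _ _ _ _ e w hc_gmean e0 _).2 ?mxE// => i.
by case: ifP.
Qed.

Lemma lhom_cv_scale a x : dominated e x -> w (cv_scale a x) = sroot a * w x.
Proof. by rewrite cv_scaleE; exact: lhomZ. Qed.

End Values.

End ConcavificationOperations.

#[export] Hint Resolve dominated_cvadd dominated_gmean dominated_cv_scale : dominated.

Section ConcavificationLaws.
Context {R : realType} {E : banachLatticeType R}.
Implicit Types (x y z e : E) (w : E -> R) (a b : R).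

(** After applying [w], the signed square carries [cvadd] to addition of reals. The other vector
    space laws of $E_{(2)}$ follow the same pattern. *)
Lemma cvaddA : associative (@cvadd R E).
Proof.
move=> x y z; have [e [e0 dx dy dz]] := common_bound x y z.
apply: (character_eq e0); auto with dominated => w [hw _].
rewrite !(lhom_cvadd e0 hw); auto with dominated.
by rewrite !srootK addrA.
Qed.

Lemma cvaddC : commutative (@cvadd R E).
Proof.
move=> x y; have [e [e0 dx dy _]] := common_bound x y 0.
apply: (character_eq e0); auto with dominated => w [hw _].
by rewrite !(lhom_cvadd e0 hw) ?[ssq (w x) + _]addrC; auto with dominated.
Qed.

Lemma cvadd0 : left_id 0 (@cvadd R E).
Proof.
move=> x; have [e [e0 dx d0 _]] := common_bound x 0 0.
apply: (character_eq e0); auto with dominated => w [hw _].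
by rewrite (lhom_cvadd e0 hw)// (lhom0 e0 hw) ssq0 add0r ssqK.
Qed.

Lemma cvaddN : left_inverse 0 -%R (@cvadd R E).
Proof.
move=> x; have [e [e0 dx d0 _]] := common_bound x 0 0.
apply: (character_eq e0); auto with dominated => w [hw _].
rewrite (lhom_cvadd e0 hw) ?(lhomN e0 hw) ?(lhom0 e0 hw); auto with dominated.
by rewrite ssqN addNr sroot0.
Qed.

Lemma cv_scaleA a b x : cv_scale a (cv_scale b x) = cv_scale (a * b) x.
Proof. by rewrite !cv_scaleE scalerA srootM. Qed.

Lemma cv_scale1 : left_id 1 (@cv_scale R E).
Proof. by move=> x; rewrite cv_scaleE sroot1 scale1r. Qed.

Lemma cv_scaleDr : right_distributive (@cv_scale R E) cvadd.
Proof.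
move=> a x y; have [e [e0 dx dy _]] := common_bound x y 0.
apply: (character_eq e0); auto with dominated => w [hw _].
rewrite !(lhom_cv_scale e0 hw, lhom_cvadd e0 hw); auto with dominated.
rewrite !ssqM.
by rewrite srootK -mulrDr srootM.
Qed.

Lemma cv_scaleDl x a b : cv_scale (a + b) x = cvadd (cv_scale a x) (cv_scale b x).
Proof.
have [e [e0 dx _ _]] := common_bound x x x.
apply: (character_eq e0); auto with dominated => w [hw _].
rewrite !(lhom_cv_scale e0 hw, lhom_cvadd e0 hw); auto with dominated.
by rewrite !ssqM !srootK -mulrDl srootM ssqK.
Qed.

Lemma cv_scaleN1 x : cv_scale (-1) x = - x.
Proof. by rewrite cv_scaleE srootN sroot1 scaleN1r. Qed.

Lemma cv_le_add x y z : x <=| y -> cvadd x z <=| cvadd y z.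
Proof.
move=> xy; have [e [e0 dx dy dz]] := common_bound x y z.
apply: (character_le e0); auto with dominated => w [hw _].
rewrite !(lhom_cvadd e0 hw)//; apply: sroot_le; rewrite lerD2r; apply: ssq_le.
exact: (lhom_le hw).
Qed.

Lemma cv_scale_ge0 a x : 0 <= a -> 0 <=| x -> 0 <=| cv_scale a x.
Proof. by move=> a0; rewrite cv_scaleE; apply: vscale_ge0; rewrite sroot_ge0// sqrtr_ge0. Qed.

End ConcavificationLaws.

HB.instance Definition _ (R : realType) (E : banachLatticeType R) :=
  Monoid.isComLaw.Build E 0 (@cvadd R E) cvaddA cvaddC cvadd0.

Section ConcavificationNorm.
Context {R : realType} {E : banachLatticeType R}.
Implicit Types (x y z v : E) (a b r : R) (s : seq E).

Lemma cv_addEcvadd : @cv_add R E = cvadd.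
Proof. by apply/funext => x; apply/funext => y; rewrite cvadd.unlock. Qed.

Lemma cv_subE x y : cv_sub x y = cvadd x (- y).
Proof. by rewrite /cv_sub cv_scaleN1 cv_addEcvadd. Qed.

(** The set in [cv_norm], with lists in place of indexed families so that covers can be concatenated
    and mapped. *)
Definition square_cover x : set R := [set r | exists s, [/\ forall v, v \in s -> 0 <=| v,
  vabs x <=| \big[cvadd/0]_(v <- s) v & r = \sum_(v <- s) `|v| ^+ 2]].

Lemma cv_normE x : cv_norm x = inf (square_cover x).
Proof.
congr inf; apply/seteqP; split=> r.
  move=> [n [v [v0 xv ->]]]; exists [seq v i | i <- enum 'I_n]; split.
  - by move=> _ /mapP[i _ ->].
  - by rewrite big_map big_enum/= -cv_addEcvadd.
  - by rewrite big_map big_enum.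
move=> [s [s0 xs ->]]; exists (size s), (tnth (in_tuple s)); split.
- by move=> i; apply: s0; exact: mem_tnth.
- by rewrite cv_addEcvadd -(big_tnth _ _ _ predT (fun v => v)).
- by rewrite (big_tnth _ _ _ predT (fun v => `|v| ^+ 2)).
Qed.

Lemma square_cover_ge0 x r : square_cover x r -> 0 <= r.
Proof. by move=> [s [_ _ ->]]; apply: sumr_ge0 => v _; exact: sqr_ge0. Qed.

Lemma square_cover_ne x : square_cover x !=set0.
Proof.
exists (`|x| ^+ 2), [:: vabs x]; split.
- by move=> v; rewrite inE => /eqP ->; exact: vabs_ge0.
- by rewrite big_seq1 vlexx.
- by rewrite big_seq1 norm_vabs.
Qed.

Lemma cv_norm_lb x r : square_cover x r -> cv_norm x <= r.
Proof.
by move=> xr; rewrite cv_normE; apply: ge_inf => //; exists 0; exact: square_cover_ge0.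
Qed.

Lemma cv_norm_glb x r : (forall t, square_cover x t -> r <= t) -> r <= cv_norm x.
Proof. by move=> xr; rewrite cv_normE; apply: lb_le_inf; first exact: square_cover_ne. Qed.

Lemma cv_norm_ge0 x : 0 <= cv_norm x.
Proof. exact: cv_norm_glb (@square_cover_ge0 x). Qed.

Lemma cvadd_le x y z v : x <=| y -> z <=| v -> cvadd x z <=| cvadd y v.
Proof.
move=> xy zv; apply: vle_trans' (cv_le_add z xy) _.
by rewrite ![cvadd y _]cvaddC; exact: cv_le_add.
Qed.

Lemma vabs_cvadd x y : vabs (cvadd x y) <=| cvadd (vabs x) (vabs y).
Proof.
apply: vabs_bound; first by apply: cvadd_le; exact: ler_vabs.
rewrite -cv_scaleN1 cv_scaleDr !cv_scaleN1.
by apply: cvadd_le; exact: lerN_vabs.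
Qed.

Lemma vabs_cv_scale a x : vabs (cv_scale a x) = cv_scale `|a| (vabs x).
Proof. by rewrite !cv_scaleE vabsZ sroot_abs. Qed.

Lemma cv_norm_le x y : vabs x <=| vabs y -> cv_norm x <= cv_norm y.
Proof.
move=> xy; apply: cv_norm_glb => r [s [s0 ys ->]]; apply: cv_norm_lb.
by exists s; split=> //; exact: vle_trans' ys.
Qed.

Lemma cv_normD x y : cv_norm (cvadd x y) <= cv_norm x + cv_norm y.
Proof.
rewrite -lerBlDr; apply: cv_norm_glb => r [s [s0 xs ->]].
rewrite lerBlDr -lerBlDl; apply: cv_norm_glb => r' [s' [s0' ys ->]].
rewrite lerBlDl; apply: cv_norm_lb; exists (s ++ s'); split.
- by move=> v; rewrite mem_cat => /orP[/s0|/s0'].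
- rewrite big_cat /=; apply: vle_trans' (vabs_cvadd _ _) _; exact: cvadd_le.
- by rewrite big_cat.
Qed.

Lemma cv_norm0 : cv_norm (0 : E) = 0.
Proof.
apply/le_anti; rewrite cv_norm_ge0 andbT; apply: cv_norm_lb; exists [::].
by rewrite !big_nil vabs0 vlexx.
Qed.

Lemma cv_normZ a x : cv_norm (cv_scale a x) = `|a| * cv_norm x.
Proof.
have le b y : cv_norm (cv_scale b y) <= `|b| * cv_norm y.
  have [->|b0] := eqVneq b 0.
    by rewrite cv_scaleE sroot0 scale0r cv_norm0 normr0 mul0r.
  have nb : 0 < `|b| by rewrite normr_gt0.
  rewrite mulrC -ler_pdivrMr//; apply: cv_norm_glb => r [s [s0 ys ->]].
  rewrite ler_pdivrMr//; apply: cv_norm_lb; exists [seq cv_scale `|b| v | v <- s]; split.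
  - by move=> _ /mapP[v vs ->]; apply: cv_scale_ge0 => //; exact: s0.
  - rewrite big_map -(big_morph (cv_scale `|b|) (cv_scaleDr _) (id1 := 0) (id2 := 0)); last first.
      by rewrite cv_scaleE scaler0.
    rewrite vabs_cv_scale !cv_scaleE; apply: vscale_le => //.
    by rewrite sroot_ge0// sqrtr_ge0.
  - rewrite big_map mulr_suml; apply: eq_bigr => v _.
    rewrite cv_scaleE normrZ exprMn mulrC; congr (_ * _).
    by rewrite sroot_ge0// ger0_norm ?sqrtr_ge0// sqr_sqrtr.
apply/le_anti; rewrite le/=.
have [->|a0] := eqVneq a 0; first by rewrite normr0 mul0r cv_norm_ge0.
(* The reverse inequality is the bound [le] for the inverse scalar. *)
rewrite -ler_pdivlMl ?normr_gt0// -normfV.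
apply: le_trans (le _ _); rewrite cv_scaleA mulVf// cv_scale1.
exact: lexx.
Qed.

(** Since $|st|\le(s^2+t^2)/2$, the elements $|x|/\sqrt2$ and $|y|/\sqrt2$ cover the geometric mean,
    and their squared norms add up to at most 1. *)
Lemma cv_norm_gmean x y : `|x| <= 1 -> `|y| <= 1 -> cv_norm (gmean x y) <= 1.
Proof.
move=> x1 y1; pose c : R := Num.sqrt 2^-1.
have c0 : 0 <= c by exact: sqrtr_ge0.
have c2 : c ^+ 2 = 2^-1 by rewrite sqr_sqrtr.
pose u := c *: vabs x; pose v := c *: vabs y.
apply: (@le_trans _ _ (`|u| ^+ 2 + `|v| ^+ 2)).
  apply: cv_norm_lb; exists [:: u; v]; split.
  - move=> t; rewrite !inE => /orP[]/eqP ->;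
      by rewrite vscale_ge0 ?vabs_ge0.
  - rewrite big_cons big_seq1.
    have [e [e0 dx dy _]] := common_bound x y 0.
    have du : dominated e u by rewrite /u; auto with dominated.
    have dv : dominated e v by rewrite /v; auto with dominated.
    apply: (character_le e0); auto with dominated => w [hw _].
    rewrite (lhom_abs e0 hw) ?(lhom_cvadd e0 hw) ?(lhom_gmean e0 hw)//; last first.
      by auto with dominated.
    rewrite /u /v !(lhomZ e0 hw) ?(lhom_abs e0 hw); auto with dominated.
    rewrite sroot_abs normrM.
    apply: sroot_le; rewrite !ssq_ge0 ?mulr_ge0// !exprMn c2.
    have := sqr_ge0 (`|w x| - `|w y|); nra.
  - by rewrite big_cons big_seq1.
rewrite !normrZ !norm_vabs !exprMn real_normK ?num_real// c2.
have : `|x| ^+ 2 <= 1 by rewrite expr_le1.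
have : `|y| ^+ 2 <= 1 by rewrite expr_le1.
by lra.
Qed.

End ConcavificationNorm.

(* The carrier of E_(2). *)
Definition concav (R : realType) (E : banachLatticeType R)
  (hE : concavification_is_Banach E) : Type := E.

Section ConcavificationStructure.
Context {R : realType} {E : banachLatticeType R} (hE : concavification_is_Banach E).

HB.instance Definition _ := Choice.copy (concav hE) E.
HB.instance Definition _ := GRing.isZmodule.Build (concav hE)
  (@cvaddA R E) (@cvaddC R E) (@cvadd0 R E) (@cvaddN R E).
HB.instance Definition _ := GRing.Zmodule_isLmodule.Build R (concav hE)
  (@cv_scaleA R E) (@cv_scale1 R E) (@cv_scaleDr R E) (@cv_scaleDl R E).
HB.instance Definition _ := isVectorLattice.Build R (concav hE)
  (@vlexx R E) (@vle_anti R E) (@vle_trans R E) (@cv_le_add R E)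
  (@cv_scale_ge0 R E) (@vmax_le R E) (@vle_min R E).
HB.instance Definition _ := Lmodule_isNormed.Build R (concav hE)
  (@cv_normD R E) (@cv_normZ R E) hE.1.

Let complete (F : set_system (concav hE)) : ProperFilter F -> cauchy F -> cvg F.
Proof.
move=> FF /cauchyP cF.
(* The hypothesis provides completeness for sequences; centres of small balls belonging to [F] form
   a Cauchy sequence whose limit is the limit of [F]. *)
have /choice[u uP] : forall n : nat, exists x, F (ball x (n.+1%:R^-1 : R)).
  by move=> n; apply: cF; rewrite invr_gt0.
have [|l lP] := hE.2 u.
  move=> d d0; have [N hN] := @natinv_lt R 1 (d / 2) (divr_gt0 d0 (ltr0n _ 2)).
  exists N => m n Nm Nn; rewrite cv_subE.
  have [x [mx nx]] := filter_ex (filterI (uP m) (uP n)).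
  have -> : cv_norm (cvadd (u m) (- u n)) = `|u m - u n| by [].
  rewrite -(subrKA x); apply: le_lt_trans (ler_normD _ _) _.
  rewrite [d]splitr ltrD//.
    by apply: lt_trans (hN _ Nm); rewrite mul1r; move: mx; rewrite -ball_normE.
  by apply: lt_trans (hN _ Nn); rewrite mul1r distrC; move: nx; rewrite -ball_normE.
apply/cvg_ex; exists (l : concav hE).
apply/cvgrPdist_lt => d d0.
have [N hN] := @natinv_lt R 1 (d / 2) (divr_gt0 d0 (ltr0n _ 2)).
have [M hM] := lP (d / 2) (divr_gt0 d0 (ltr0n _ 2)).
pose n := maxn N M.
near=> x; rewrite -(subrKA (u n)); apply: le_lt_trans (ler_normD _ _) _.
rewrite [d]splitr ltrD//.
  rewrite distrC; have := hM n (leq_maxr _ _); by rewrite cv_subE.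
apply: lt_trans (hN n (leq_maxl _ _)); rewrite mul1r.
near: x; have := uP n; rewrite -ball_normE; exact.
Unshelve. all: by end_near. Qed.

HB.instance Definition _ := Uniform_isComplete.Build (concav hE) complete.

HB.instance Definition _ := isBanachLattice.Build R (concav hE) (@cv_norm_le R E).

End ConcavificationStructure.

(** * The Fremlin tensor product *)

Section TensorEvaluation.
Context {R : realType}.

Section Algebra.
Context {E F G : lmodType R} (phi : {bilinear E -> F -> G}).
Implicit Types (s t : seq (E * F)) (a : R).

Lemma tensor_eval_cat s t :
  tensor_eval phi (s ++ t) = tensor_eval phi s + tensor_eval phi t.
Proof. exact: big_cat. Qed.

Definition tensor_scale a s := [seq (a *: p.1, p.2) | p <- s].

Lemma tensor_eval_scale a s :
  tensor_eval phi (tensor_scale a s) = a *: tensor_eval phi s.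
Proof.
rewrite /tensor_eval big_map scaler_sumr; apply: eq_bigr => p _ /=.
by rewrite linearZl_LR.
Qed.

Lemma tensor_eval1 x y : tensor_eval phi [:: (x, y)] = phi x y.
Proof. exact: big_seq1. Qed.

End Algebra.

Definition contractive_bilinear (E F G : banachLatticeType R)
    (phi : {bilinear E -> F -> G}) : Prop :=
  forall x y, `|x| <= 1 -> `|y| <= 1 -> `|phi x y| <= 1.

Section Norms.
Context {E F G : banachLatticeType R} (phi : {bilinear E -> F -> G}).
Hypothesis phi1 : contractive_bilinear phi.

Lemma contractive_bilinear_le x y : `|phi x y| <= `|x| * `|y|.
Proof.
have [->|x0] := eqVneq x 0; first by rewrite linear0l !normr0 mul0r.
have [->|y0] := eqVneq y 0; first by rewrite linear0r !normr0 mulr0.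
have nx : 0 < `|x| by rewrite normr_gt0.
have ny : 0 < `|y| by rewrite normr_gt0.
have unit (V : normedModType R) (v : V) : 0 < `|v| -> `| (`|v|)^-1 *: v | <= 1.
  by move=> v0; rewrite normrZ normfV normr_id mulVf// gt_eqF.
have := phi1 (unit _ _ nx) (unit _ _ ny).
rewrite linearZl_LR linearZr_LR scalerA normrZ normrM !normfV !normr_id.
by rewrite -invfM mulrC ler_pdivrMr ?mulr_gt0// mul1r.
Qed.

Lemma tensor_eval_bound s : `|tensor_eval phi s| <= \sum_(p <- s) `|p.1| * `|p.2|.
Proof.
apply: le_trans (ler_norm_sum _ _ _) _.
by apply: ler_sum => p _; exact: contractive_bilinear_le.
Qed.

End Norms.

Section FremlinTensor.
Context {E F P : banachLatticeType R} {tens : {bilinear E -> F -> P}}.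
Hypothesis hP : is_fremlin_tensor tens.

Lemma fremlin_norm_ge (G : banachLatticeType R) (phi : {bilinear E -> F -> G}) s :
  positive_bilinear phi -> contractive_bilinear phi ->
  `|tensor_eval phi s| <= `|tensor_eval tens s|.
Proof.
move=> phi0 phi1; have [-> _ _] := hP; apply: ub_le_sup; last by exists G, phi.
exists (\sum_(p <- s) `|p.1| * `|p.2|) => _ [G' [psi [psi0 psi1 ->]]].
exact: tensor_eval_bound.
Qed.

Lemma tensor_norm_le x y : `|tens x y| <= `|x| * `|y|.
Proof.
have [tE _ _] := hP; rewrite -tensor_eval1 tE /fremlin_norm.
set A := (X in sup X).
(* On an empty set [sup] takes the default value 0, which satisfies the bound too. *)
have [A0|A0] := pselect (A !=set0); last first.
  by rewrite sup_out ?mulr_ge0// => -[].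
apply: sup_le_ub => // _ [G [phi [phi0 phi1 ->]]].
by rewrite tensor_eval1; exact: contractive_bilinear_le.
Qed.

Lemma tensor_dense u (d : R) : 0 < d -> exists s, `|u - tensor_eval tens s| < d.
Proof.
move=> d0; have [_ dense _] := hP.
have : closure (range (tensor_eval tens)) u by rewrite dense.
move=> /(_ _ (nbhsx_ballx u d d0))[_ [[s _ <-]]].
by rewrite -ball_normE; exists s.
Qed.

Lemma tensor_positive_dense u (d : R) : 0 <=| u -> 0 < d -> exists2 s,
  (forall p, p \in s -> 0 <=| p.1 /\ 0 <=| p.2) & `|u - tensor_eval tens s| < d.
Proof.
move=> u0 d0; have [_ _ cone] := hP.
have : [set u | 0 <=| u] u by [].
rewrite cone => /(_ _ (nbhsx_ballx u d d0))[_ [[s s0 ->]]].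
by rewrite -ball_normE; exists s.
Qed.

Lemma tensor_positive : positive_bilinear tens.
Proof.
move=> x y x0 y0; have [_ _ cone] := hP.
suff : [set u | 0 <=| u] (tens x y) by [].
rewrite cone; apply: subset_closure; exists [:: (x, y)]; last by rewrite tensor_eval1.
by move=> p; rewrite inE => /eqP ->.
Qed.

Section Universal.
Context {G : banachLatticeType R} {phi : {bilinear E -> F -> G}}.
Hypotheses (phi0 : positive_bilinear phi) (phi1 : contractive_bilinear phi).

Let tensor_eval_dist s t : `|tensor_eval phi s - tensor_eval phi t| <=
  `|tensor_eval tens s - tensor_eval tens t|.
Proof.
rewrite -[_ - tensor_eval phi t](_ : tensor_eval phi (s ++ tensor_scale (-1) t) = _).
  apply: le_trans (fremlin_norm_ge _ phi0 phi1) _.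
  by rewrite tensor_eval_cat tensor_eval_scale scaleN1r.
by rewrite tensor_eval_cat tensor_eval_scale scaleN1r.
Qed.

(** The closure of the pairs of values of [tens] and [phi] on the same list. As one tensor has many
    representing lists, the extension is built as this relation and shown to be a function by
    [graph_dist]. *)
Let graph u z := forall d : R, 0 < d ->
  exists2 s, `|u - tensor_eval tens s| < d & `|z - tensor_eval phi s| < d.

Let graph_exists u : exists z, graph u z.
Proof.
have /choice[s sP] : forall n : nat, exists s, `|u - tensor_eval tens s| < n.+1%:R^-1.
  by move=> n; apply: tensor_dense; rewrite invr_gt0.
have [|z zP] := @cauchy_seq_limit R G 2 (fun n => tensor_eval phi (s n)).
  move=> n m nm; apply: le_trans (tensor_eval_dist _ _) _.
  rewrite -(subrKA u); apply: le_trans (ler_normD _ _) _.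
  rewrite distrC mulr2n mulrDl mul1r lerD// ?(ltW (sP n))//.
  by apply: le_trans (ltW (sP m)) _; rewrite lef_pV2 ?posrE// ler_nat.
exists z => d d0; have [N hN] := zP d d0.
have [M hM] := natinv_lt 1 d0.
exists (s (maxn N M)); last by apply: hN; rewrite leq_maxl.
by apply: lt_trans (sP _) _; rewrite -[_^-1]mul1r; apply: hM; rewrite leq_maxr.
Qed.

Let graph_dist u v z y : graph u z -> graph v y -> `|z - y| <= `|u - v|.
Proof.
move=> uz vy; apply/ler_addgt0Pr => d d0.
have d4 : 0 < d / 4 by rewrite divr_gt0.
have [s us zs] := uz _ d4; have [t vt yt] := vy _ d4.
have := tensor_eval_dist s t.
set a := tensor_eval phi s in zs *; set b := tensor_eval phi t in yt *.
set f := tensor_eval tens s in us *; set g := tensor_eval tens t in vt *.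
move=> ab.
have h1 : `|z - y| <= `|z - a| + `|a - b| + `|y - b|.
  have -> : z - y = (z - a) + (a - b) - (y - b) by rewrite subrKA opprB subrKA.
  by apply: le_trans (ler_normB _ _) _; rewrite lerD2r ler_normD.
have h2 : `|f - g| <= `|u - f| + `|u - v| + `|v - g|.
  have -> : f - g = (f - u) + (u - v) + (v - g) by rewrite !subrKA.
  apply: le_trans (ler_normD _ _) _; rewrite lerD2r (distrC u f).
  exact: ler_normD.
lra.
Qed.

Let graph_lin a u v z y : graph u z -> graph v y -> graph (a *: u + v) (a *: z + y).
Proof.
move=> uz vy d d0; have c0 : 0 < `|a| + 1 by rewrite ltr_wpDl.
have h0 : 0 < d / (`|a| + 1) by rewrite divr_gt0.
have [s us zs] := uz _ h0; have [t vt yt] := vy _ h0.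
have bound (V : normedModType R) (p q p' q' : V) :
    `|p - p'| < d / (`|a| + 1) -> `|q - q'| < d / (`|a| + 1) ->
    `|a *: p + q - (a *: p' + q')| < d.
  move=> pp qq; rewrite opprD addrACA -scalerBr; apply: le_lt_trans (ler_normD _ _) _.
  rewrite normrZ -[ltRHS](divfK (lt0r_neq0 c0)) mulrDr mulr1.
  by apply: ler_ltD => //; rewrite mulrC; apply: ler_wpM2r => //; exact: ltW.
by exists (tensor_scale a s ++ t); rewrite tensor_eval_cat tensor_eval_scale;
  exact: bound.
Qed.

(** The Fremlin norm dominates the norm of every admissible evaluation, so the closed graph is that
    of a contraction. Positivity passes to the limit because sums of positive elementary tensors are
    dense in the cone. *)
Lemma fremlin_universal : exists T : P -> G,
  [/\ forall a u v, T (a *: u + v) = a *: T u + T v,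
      forall u, `|T u| <= `|u|,
      forall u, 0 <=| u -> 0 <=| T u
    & forall s, T (tensor_eval tens s) = tensor_eval phi s].
Proof.
have /choice[T TP] := graph_exists.
have graphE u z : graph u z -> T u = z.
  move=> uz; apply/eqP; rewrite -subr_eq0 -normr_le0.
  by apply: le_trans (graph_dist (TP u) uz) _; rewrite subrr normr0.
have graph_tens s : graph (tensor_eval tens s) (tensor_eval phi s).
  by move=> d d0; exists s; rewrite subrr normr0.
exists T; split.
- by move=> a u v; apply: graphE; exact: graph_lin.
- move=> u; have := graph_dist (TP u) (graph_tens [::]).
  by rewrite /tensor_eval !big_nil !subr0.
- move=> u u0; rewrite -vle_opp2 oppr0; apply: vle_closure => d d0.
  have [s s0 us] := tensor_positive_dense u0 d0.
  exists (- tensor_eval phi s).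
    rewrite -oppr0 vle_opp2 /tensor_eval big_seq.
    apply: (big_ind (fun v => 0 <=| v)); [exact: vlexx|exact: vle_add0|].
    by move=> p /s0[p1 p2]; exact: phi0.
  rewrite -opprD normrN; apply: le_lt_trans us.
  exact: graph_dist (TP u) (graph_tens s).
- by move=> s; exact: graphE.
Qed.

End Universal.
End FremlinTensor.
End TensorEvaluation.

(** * Orthosymmetric bilinear maps *)

Section Partitions.
Context {R : realType} {E : banachLatticeType R}.
Implicit Types (x y z p r e : E) (w : E -> R) (d : R) (s : seq E).

(** With elements of the principal ideal viewed as functions on its characters, [z] varies by at
    most [d] on the set where [p] is positive. *)
Definition oscillates_le e d p z : Prop := forall w w',
  character e w -> character e w' -> 0 < w p -> 0 < w' p -> `|w z - w' z| <= d.

(* p is cut at the levels p /\ ((z - a_k e)^+ / m) for a_k running through an  *)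
(* arithmetic progression of step m = d / 2.                                   *)
Lemma refine_positive e z p d : 0 <=| e -> dominated e z -> 0 <=| p -> p <=| e ->
  0 < d -> exists s, [/\ forall r, r \in s -> 0 <=| r /\ r <=| p,
    \sum_(r <- s) r = p & forall r, r \in s -> oscillates_le e d r z].
Proof.
move=> e0 dz p0 pe d0; have [c c0] := dominated_pos e0 dz.
rewrite vabs_le => /andP[zc zNc].
have dp : dominated e p by exists 1; rewrite scale1r vabs_ge0_id.
pose m := d / 2; have m0 : 0 < m by rewrite divr_gt0.
pose a (k : nat) : R := k%:R * m - c - m.
pose h k := m^-1 *: vpos (z - a k *: e).
pose g k := p \wedge h k.
have dh k : dominated e (h k) by rewrite /h /vpos; auto 10 with dominated.
have dg k : dominated e (g k) by rewrite /g; auto with dominated.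
have h_ge0 k : 0 <=| h k by apply: vscale_ge0; rewrite ?invr_ge0 ?(ltW m0)//; exact: vpos_ge0.
have wh k w : character e w -> w (h k) = m^-1 * Num.max (w z - a k) 0.
  move=> [hw we]; rewrite /h /vpos (lhomZ e0 hw) ?(lhom_max hw); auto 10 with dominated.
  by rewrite (lhomB e0 hw) ?(lhomZ e0 hw) ?(lhom0 e0 hw) ?we ?mulr1; auto with dominated.
have wg k w : character e w -> w (g k) = Num.min (w p) (w (h k)).
  by move=> [hw we]; rewrite /g (lhom_min e0 hw).
have ha k : h k.+1 <=| h k.
  apply: (character_le e0) => // w cw; rewrite !wh// ler_wpM2l ?invr_ge0 ?(ltW m0)//.
  rewrite ge_max !le_max lexx orbT andbT lerD2l lerN2.
  by rewrite /a -natr1; apply/orP; left; lra.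
(* This makes the level [a N] at least [c], hence [h N = 0], while the first level [- c - m] makes
   [h 0] at least [e]. The pieces therefore telescope to [p]. *)
have [N hN] : exists N : nat, 2 * c + m <= N%:R * m.
  exists (Num.truncn ((2 * c + m) / m)).+1.
  by rewrite -ler_pdivrMr// ltW// truncnS_gt.
have g0 : g 0%N = p.
  apply/vmin_eql/(vle_trans' pe); rewrite /h -[X in X <=| _](scale1r e).
  rewrite -(mulVf (lt0r_neq0 m0)) -scalerA; apply: vscale_le; first by rewrite invr_ge0 ltW.
  apply: vle_trans' (vpos_ge _); rewrite /a mul0r sub0r -opprD scaleNr opprK scalerDl.
  by rewrite addrA; apply: vle_addl; rewrite -vle_opp2 oppr0 opprD vle_subLR add0r.
have gN : g N = 0.
  apply: vle_eq; last by rewrite vle_min p0 h_ge0.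
  apply: vle_trans' (vminr _ _) _; rewrite /h (vpos_eq0 _).2 ?scaler0 ?vlexx//.
  rewrite vle_subLR add0r; apply: vle_trans' zc _; apply: vscale_lel => //.
  by rewrite /a; lra.
have ga k : g k.+1 <=| g k by rewrite vle_min vminl/=; exact: vle_trans' (vminr _ _) (ha k).
exists [seq g k - g k.+1 | k <- index_iota 0 N]; split.
- move=> _ /mapP[k _ ->]; rewrite vle_sub; split; first exact: ga.
  rewrite vle_subLR; apply: vle_trans' (vminl _ _) _; apply: vle_addr.
  by rewrite vle_min p0 h_ge0.
- rewrite big_map (@telescope_sumr_eq _ _ _ (fun k => - g k))// => [|k _].
    by rewrite g0 gN oppr0 sub0r opprK.
  by rewrite opprK addrC.
(* Below the level [a k] both truncations vanish at [w]; above [a k + d] both are at least 1 and so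
   equal [w p] after the infimum. In either case the piece vanishes. *)
- move=> _ /mapP[k _ ->]; suff osc w : character e w -> 0 < w (g k - g k.+1) ->
      a k <= w z <= a k + d.
    move=> w w' cw cw' /(osc _ cw)/andP[? ?] /(osc _ cw')/andP[? ?].
    by rewrite ler_norml; apply/andP; split; lra.
  move=> cw; rewrite (lhomB e0 cw.1)// !wg// !wh//.
  have wp1 : w p <= 1 by rewrite -cw.2; apply: (lhom_le cw.1) => //; exact: dominated_self.
  have aS : a k.+1 = a k + m by rewrite /a -natr1; lra.
  have dm : d = 2 * m by rewrite /m; lra.
  have mi : m^-1 * m = 1 by rewrite mulVf// gt_eqF.
  rewrite aS; case: (leP (w z - a k) 0) => h1; case: (leP (w z - (a k + m)) 0) => h2;
  rewrite ?mulr0 ?subrr ?ltxx//.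
  - by lra.
  - by move=> _; apply/andP; split; lra.
  - move=> h3; apply/andP; split; first lra.
    rewrite leNgt; apply/negP => h4.
    have h5 : 1 <= m^-1 * (w z - (a k + m)).
      by rewrite -mi ler_wpM2l ?invr_ge0 ?(ltW m0)//; lra.
    have h6 : 1 <= m^-1 * (w z - a k).
      by rewrite -mi ler_wpM2l ?invr_ge0 ?(ltW m0)//; lra.
    by move: h3; rewrite !min_l ?subrr ?ltxx//; lra.
Qed.

(** The elements of [Z] are treated one by one. Cutting a piece further only shrinks the set where
    it is positive, so earlier oscillation bounds survive. *)
Lemma partition_of_unity e (Z : seq E) d : 0 <=| e ->
  (forall z, z \in Z -> dominated e z) -> 0 < d ->
  exists s, [/\ forall p, p \in s -> 0 <=| p /\ p <=| e, \sum_(p <- s) p = e &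
    forall p z, p \in s -> z \in Z -> oscillates_le e d p z].
Proof.
move=> e0 + d0; elim: Z => [_|z Z IHZ dZ].
  exists [:: e]; split=> //; last by rewrite big_seq1.
  by move=> p; rewrite inE => /eqP ->; rewrite vlexx.
have [|s [s0 se sZ]] := IHZ; first by move=> y yZ; apply: dZ; rewrite in_cons yZ orbT.
have dz : dominated e z by apply: dZ; rewrite mem_head.
have /choice[f fP] : forall p, exists t, 0 <=| p -> p <=| e ->
    [/\ forall r, r \in t -> 0 <=| r /\ r <=| p, \sum_(r <- t) r = p &
    forall r, r \in t -> oscillates_le e d r z].
  move=> p; have [p0|p0] := pselect (0 <=| p /\ p <=| e); last first.
    by exists [::] => p1 p2; case: p0.
  by have [t tP] := refine_positive e0 dz p0.1 p0.2 d0; exists t.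
have memf r : r \in flatten [seq f p | p <- s] -> exists2 p, p \in s & r \in f p.
  by move=> /flattenP[_ /mapP[p ps ->] rp]; exists p.
exists (flatten [seq f p | p <- s]); split.
- move=> r /memf[p ps rp]; have [p0 pe] := s0 _ ps; have [fp _ _] := fP _ p0 pe.
  by have [r0 rp'] := fp _ rp; split=> //; exact: vle_trans' pe.
- rewrite big_flatten big_map -[RHS]se; apply: eq_big_seq => p ps.
  by have [p0 pe] := s0 _ ps; have [_ -> _] := fP _ p0 pe.
- move=> r y /memf[p ps rp]; have [p0 pe] := s0 _ ps; have [fp _ fz] := fP _ p0 pe.
  rewrite in_cons => /predU1P[->|yZ]; first exact: fz.
  have [r0 rp'] := fp _ rp.
  have dp : dominated e p by exists 1; rewrite scale1r vabs_ge0_id.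
  have dr : dominated e r.
    by exists 1; rewrite scale1r vabs_ge0_id//; exact: vle_trans' pe.
  move=> w w' cw cw' wr wr'; apply: (sZ p y ps yZ) => //.
    by apply: lt_le_trans wr _; exact: (lhom_le cw.1).
  by apply: lt_le_trans wr' _; exact: (lhom_le cw'.1).
Qed.

End Partitions.

Section LinearCombinations.
Context {R : realType} {V : vectorLatticeType R}.
Implicit Types (e : V) (w : V -> R) (s : seq V) (f : V -> R).

Lemma dominated_sum e s f : 0 <=| e -> (forall p, p \in s -> dominated e p) ->
  dominated e (\sum_(p <- s) f p *: p).
Proof.
move=> e0 ds; rewrite big_seq; apply: big_ind; first exact: dominated0.
- exact: dominatedD.
- by move=> p /ds; exact: dominatedZ.
Qed.

Lemma lhom_sum e s f w : 0 <=| e -> lattice_hom e w ->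
  (forall p, p \in s -> dominated e p) ->
  w (\sum_(p <- s) f p *: p) = \sum_(p <- s) f p * w p.
Proof.
move=> e0 hw; elim: s => [|p s IHs] ds; first by rewrite !big_nil (lhom0 e0 hw).
have ds' q : q \in s -> dominated e q by move=> qs; apply: ds; rewrite in_cons qs orbT.
rewrite !big_cons hw.1 ?IHs//; first by apply: ds; rewrite mem_head.
exact: dominated_sum.
Qed.

End LinearCombinations.

Section Orthosymmetric.
Context {R : realType} {E : banachLatticeType R} {W : vectorLatticeType R}.
Variable B : {bilinear E -> E -> W}.
Hypotheses (B0 : positive_bilinear B)
  (Bdisj : forall x y, vdisjoint x y -> B x y = 0)
  (archW : forall u v : W, (forall d : R, 0 < d -> - (d *: v) <=| u) -> 0 <=| u).
Implicit Types (x y z p q e : E) (w : E -> R) (a b d : R) (s : seq (E * E)).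

Lemma vle_sum (V : vectorLatticeType R) (I : eqType) (r : seq I) (f g : I -> V) :
  (forall i, i \in r -> f i <=| g i) -> \sum_(i <- r) f i <=| \sum_(i <- r) g i.
Proof.
move=> fg; rewrite !big_seq; apply: (big_ind2 (fun u v : V => u <=| v)) => //.
- exact: vlexx.
- by move=> *; exact: vle_add.
Qed.

Lemma positive_bilinear_le x y u v : 0 <=| x -> x <=| u -> 0 <=| y -> y <=| v ->
  B x y <=| B u v.
Proof.
move=> x0 xu y0 yv; apply: (@vle_trans' _ _ (B u y)).
  by rewrite -vle_sub -linearBl; apply: B0 => //; rewrite vle_sub.
rewrite -vle_sub -linearBr; apply: B0; last by rewrite vle_sub.
exact: vle_trans' xu.
Qed.

(** Adding $B(|x|+x,|y|+y)\ge0$ and $B(|x|-x,|y|-y)\ge0$ cancels the mixed terms and leaves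
    $2(B(|x|,|y|)+B(x,y))\ge0$. *)
Lemma positive_bilinear_abs x y : - B (vabs x) (vabs y) <=| B x y.
Proof.
have p1 z : 0 <=| vabs z + z by rewrite -vle_subLR sub0r lerN_vabs.
have p2 z : 0 <=| vabs z - z by rewrite vle_sub ler_vabs.
have := vle_add0 (B0 (p1 x) (p1 y)) (B0 (p2 x) (p2 y)).
set u := B (vabs x) (vabs y); set v := B x y.
have -> : B (vabs x + x) (vabs y + y) = (u + v) + (B (vabs x) y + B x (vabs y)).
  by rewrite linearDl !linearDr [RHS]addrACA [v + _]addrC.
have -> : B (vabs x - x) (vabs y - y) = (u + v) - (B (vabs x) y + B x (vabs y)).
  by rewrite linearBl !linearBr opprB addrACA -opprD.
rewrite addrACA subrr addr0 -mulr2n -scaler_nat.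
move=> uv; have : 0 <=| 2^-1 *: (2 *: (u + v)) by apply: vscale_ge0 => //; rewrite invr_ge0.
by rewrite scalerA mulVf// scale1r [u + v]addrC -vle_subLR sub0r.
Qed.

Lemma positive_bilinear_bound e x y a b : 0 <=| e -> 0 <= a -> 0 <= b ->
  vabs x <=| a *: e -> vabs y <=| b *: e -> - ((a * b) *: B e e) <=| B x y.
Proof.
move=> e0 a0 b0 xa yb; apply: vle_trans' (positive_bilinear_abs x y).
have -> : (a * b) *: B e e = B (a *: e) (b *: e).
  by rewrite linearZl_LR linearZr_LR scalerA.
by rewrite vle_opp2; apply: positive_bilinear_le => //; exact: vabs_ge0.
Qed.

Lemma bilinear_sum2 (r : seq E) (f g : E -> R) :
  B (\sum_(p <- r) f p *: p) (\sum_(q <- r) g q *: q) =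
  \sum_(p <- r) \sum_(q <- r) (f p * g q) *: B p q.
Proof.
rewrite linear_sumlz; apply: eq_bigr => p _.
rewrite linear_sumr; apply: eq_bigr => q _.
by rewrite linearZl_LR linearZr_LR scalerA.
Qed.

(* Up to a uniform error, the elements of s are combinations of a partition of *)
(* unity on whose members they barely oscillate; products of disjoint members  *)
(* vanish, and the remaining coefficients are almost values of the sum at a    *)
(* character.                                                                  *)
Lemma orthosymmetric_ge0 e s : 0 <=| e ->
  (forall u, u \in s -> dominated e u.1 /\ dominated e u.2) ->
  (forall w, character e w -> 0 <= \sum_(u <- s) w u.1 * w u.2) ->
  0 <=| tensor_eval B s.
Proof.
move=> e0 ds sw.
have BE : 0 <=| B e e by exact: B0.
pose Z := [seq u.1 | u <- s] ++ [seq u.2 | u <- s].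
have s1Z u : u \in s -> u.1 \in Z /\ u.2 \in Z.
  by move=> us; rewrite !mem_cat !(map_f _ us) orbT.
have dZ z : z \in Z -> dominated e z.
  by rewrite mem_cat => /orP[]/mapP[p /ds[d1 d2] ->].
have [c c0 cZ] : exists2 c : R, 0 < c & forall z, z \in Z -> vabs z <=| c *: e.
  move: dZ; elim: Z {s1Z} => [_|z Z IHZ dZ]; first by exists 1.
  have [|c c0 cZ] := IHZ; first by move=> y yZ; apply: dZ; rewrite in_cons yZ orbT.
  have [|b b0 zb] := dominated_pos e0 (dZ z _); first by rewrite mem_head.
  exists (b + c); first by rewrite addr_gt0.
  move=> y; rewrite in_cons => /predU1P[->|/cZ yc].
    by apply: vle_trans' zb _; apply: vscale_lel => //; rewrite lerDl ltW.
  by apply: vle_trans' yc _; apply: vscale_lel => //; rewrite lerDr ltW.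
pose n : R := (size s)%:R.
have n0 : 0 <= n by rewrite ler0n.
apply: (archW (v := B e e)) => d d0.
(* The total error will be [4 * c * t * n], half from the coefficients and half from the
   approximation; with [t := d / k] it is at most [d], and the summand 1 keeps [k] positive. *)
pose k := 4 * c * n + 1.
have k0 : 0 < k by rewrite ltr_wpDl// !mulr_ge0// ltW.
pose t := d / k; have t0 : 0 < t by rewrite divr_gt0.
have [ps [ps0 pse psZ]] := partition_of_unity e0 dZ t0.
have dp p : p \in ps -> dominated e p.
  by move=> /ps0[p0 pe]; exists 1; rewrite scale1r vabs_ge0_id.
(* A sample character for each piece. Its value is arbitrary on pieces where every character
   vanishes, since those contribute nothing below. *)
have /choice[f fP] : forall p, exists w, (exists2 w, character e w & 0 < w p) ->
    character e w /\ 0 < w p.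
  move=> p; have [[w cw wp]|h] := pselect (exists2 w, character e w & 0 < w p).
    by exists w.
  by exists (fun=> 0).
pose ap z := \sum_(p <- ps) f p z *: p.
have wval w z : character e w -> w (ap z) = \sum_(p <- ps) f p z * w p.
  by move=> [hw _]; rewrite /ap (@lhom_sum _ _ e ps (fun p => f p z) w).
have dap z : dominated e (ap z) by exact: (@dominated_sum _ _ e ps (fun p => f p z)).
have wsum w : character e w -> \sum_(p <- ps) w p = 1.
  move=> [hw we]; rewrite -we -[in RHS]pse.
  rewrite [in RHS](eq_bigr (fun p => (fun=> 1) p *: p)); last by move=> p _; rewrite scale1r.
  by rewrite (@lhom_sum _ _ e ps (fun=> 1) w)//; apply: eq_bigr => p _; rewrite mul1r.
have wp0 w p : character e w -> p \in ps -> 0 <= w p.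
  move=> [hw _] pps; rewrite -(lhom0 e0 hw); apply: (lhom_le hw); auto with dominated.
  by have [] := ps0 _ pps.
have wc w z : character e w -> z \in Z -> `|w z| <= c.
  move=> [hw we] zZ; rewrite -(lhom_abs e0 hw); last exact: dZ.
  rewrite -[c]mulr1 -we -(lhomZ e0 hw); last exact: dominated_self.
  by apply: (lhom_le hw); auto with dominated.
have fclose w p z : character e w -> p \in ps -> 0 < w p -> z \in Z ->
    character e (f p) /\ `|w z - f p z| <= t.
  move=> cw pps wp zZ; have [|cf fp] := fP p; first by exists w.
  by split=> //; exact: (psZ p z).
have apZ z : z \in Z -> vabs (z - ap z) <=| t *: e /\ vabs (ap z) <=| c *: e.
  move=> zZ; have dz := dZ _ zZ.
  split; apply: (character_le e0); auto 10 with dominated => w cw; have [hw we] := cw.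
    rewrite (lhom_abs e0 hw) ?(lhomB e0 hw) ?(lhomZ e0 hw) ?we ?mulr1 ?wval;
      auto with dominated.
    rewrite -[w z]mulr1 -(wsum w cw) mulr_sumr -sumrB.
    apply: le_trans (ler_norm_sum _ _ _) _.
    rewrite -[leRHS]mulr1 -(wsum w cw) mulr_sumr big_seq [leRHS]big_seq.
    apply: ler_sum => p pps; rewrite -mulrBl normrM [X in _ * X]ger0_norm ?wp0//.
    have := wp0 _ _ cw pps; rewrite le_eqVlt => /predU1P[<-|wp]; first by rewrite !mulr0.
    by apply: ler_wpM2r; [exact: ltW|exact: (fclose w p z cw pps wp zZ).2].
  rewrite (lhom_abs e0 hw) ?(lhomZ e0 hw) ?we ?mulr1 ?wval; auto with dominated.
  apply: le_trans (ler_norm_sum _ _ _) _.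
  rewrite -[leRHS]mulr1 -(wsum w cw) mulr_sumr big_seq [leRHS]big_seq.
  apply: ler_sum => p pps; rewrite normrM [X in _ * X]ger0_norm ?wp0//.
  have := wp0 _ _ cw pps; rewrite le_eqVlt => /predU1P[<-|wp]; first by rewrite !mulr0.
  apply: ler_wpM2r; first exact: ltW.
  by apply: wc => //; exact: (fclose w p z cw pps wp zZ).1.
(* If [p] and [q] are disjoint, [B p q] is zero. Otherwise a character [w] is positive on both, and
   on [Z] both samples are within [t] of [w], so the coefficient is nearly the nonnegative sum at
   [w]. *)
have coeff p q : p \in ps -> q \in ps ->
    - ((2 * c * t * n) *: B p q) <=| (\sum_(u <- s) f p u.1 * f q u.2) *: B p q.
  move=> pps qps; have [p0 pe] := ps0 _ pps; have [q0 qe] := ps0 _ qps.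
  have [pq|pq] := pselect (vdisjoint p q).
    by rewrite (Bdisj pq) !scaler0 oppr0 vlexx.
  have [w cw wpq] : exists2 w, character e w & 0 < w (p \wedge q).
    apply: contrapT => nw; apply: pq; rewrite /vdisjoint !vabs_ge0_id//.
    apply: vle_eq; last by rewrite vle_min p0.
    apply: (character_le e0); auto with dominated => w cw.
    rewrite (lhom0 e0 cw.1) leNgt; apply/negP => wpq; apply: nw; by exists w.
  move: wpq; rewrite (lhom_min e0 cw.1) ?lt_min; auto with dominated => /andP[wp wq].
  rewrite -scaleNr; apply: vscale_lel; first exact: B0.
  apply: (@le_trans _ _ (\sum_(u <- s) (w u.1 * w u.2 - 2 * c * t))).
    rewrite sumrB -[leLHS]add0r; apply: lerD; first exact: sw.
    by rewrite big_const_seq count_predT iter_addr_0 lerN2 mulr_natr.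
  rewrite big_seq [leRHS]big_seq; apply: ler_sum => u us.
  have [u1 u2] := s1Z _ us.
  have [cfp fp] := fclose w p u.1 cw pps wp u1.
  have [cfq fq] := fclose w q u.2 cw qps wq u2.
  have b1 := wc w u.1 cw u1. have b2 := wc (f q) u.2 cfq u2.
  rewrite lerBlDr -lerBlDl.
  have -> : w u.1 * w u.2 - f p u.1 * f q u.2 =
      w u.1 * (w u.2 - f q u.2) + (w u.1 - f p u.1) * f q u.2 by ring.
  apply: le_trans (ler_norm _) _; apply: le_trans (ler_normD _ _) _; rewrite !normrM.
  have -> : 2 * c * t = c * t + t * c by ring.
  by apply: lerD; apply: ler_pM.
have main : - ((2 * c * t * n) *: B e e) <=| \sum_(u <- s) B (ap u.1) (ap u.2).
  have -> : \sum_(u <- s) B (ap u.1) (ap u.2) =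
      \sum_(p <- ps) \sum_(q <- ps) (\sum_(u <- s) f p u.1 * f q u.2) *: B p q.
    under eq_bigr do rewrite bilinear_sum2.
    rewrite exchange_big; apply: eq_bigr => p _ /=.
    by rewrite exchange_big; apply: eq_bigr => q _; rewrite -scaler_suml.
  have -> : - ((2 * c * t * n) *: B e e) =
      \sum_(p <- ps) \sum_(q <- ps) - ((2 * c * t * n) *: B p q).
    rewrite -[in B e e]pse linear_sumlz -scaleNr scaler_sumr; apply: eq_bigr => p _.
    by rewrite linear_sumr scaler_sumr; apply: eq_bigr => q _; rewrite scaleNr.
  by apply: vle_sum => p pps; apply: vle_sum => q qps; exact: coeff.
(* The factors are replaced one at a time, each at a cost of [t * c] times [B e e]. *)
have step u : u \in s -> - ((2 * c * t) *: B e e) + B (ap u.1) (ap u.2) <=| B u.1 u.2.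
  move=> us; have [u1 u2] := s1Z _ us.
  have [a1 b1] := apZ _ u1; have [a2 b2] := apZ _ u2.
  have -> : B u.1 u.2 =
      B (u.1 - ap u.1) u.2 + B (ap u.1) (u.2 - ap u.2) + B (ap u.1) (ap u.2).
    by rewrite -addrA -linearDr subrK -linearDl subrK.
  rewrite vle_add2rE.
  have -> : 2 * c * t = t * c + c * t by ring.
  rewrite scalerDl opprD; apply: vle_add;
    apply: positive_bilinear_bound => //; rewrite ?ltW//; exact: cZ.
apply: (@vle_trans' _ _ (\sum_(u <- s) (- ((2 * c * t) *: B e e) + B (ap u.1) (ap u.2))));
  last exact: vle_sum.
rewrite big_split /=; apply: (@vle_trans' _ _ (- ((4 * c * t * n) *: B e e))).
  rewrite vle_opp2; apply: vscale_lel => //.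
  rewrite (_ : 4 * c * t * n = t * (4 * c * n)); last by ring.
  rewrite -[leRHS](divfK (lt0r_neq0 k0)) -/t; apply: ler_wpM2l; first exact: ltW.
  by rewrite /k lerDl.
rewrite (_ : 4 * c * t * n = 2 * c * t * n + 2 * c * t * n); last by ring.
rewrite scalerDl opprD; apply: vle_add => //.
rewrite big_const_seq count_predT iter_addr_0 mulNrn scalerMnl.
rewrite -[_ *+ size s]mulr_natr; exact: vlexx.
Qed.

Lemma orthosymmetric_eq0 e s : 0 <=| e ->
  (forall u, u \in s -> dominated e u.1 /\ dominated e u.2) ->
  (forall w, character e w -> \sum_(u <- s) w u.1 * w u.2 = 0) ->
  tensor_eval B s = 0.
Proof.
move=> e0 ds sw; apply: vle_eq; last first.
  by apply: orthosymmetric_ge0 ds _ => // w cw; rewrite sw.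
rewrite -vle_opp2 oppr0 -scaleN1r -tensor_eval_scale.
apply: (@orthosymmetric_ge0 e) => //.
  by move=> _ /mapP[p /ds[d1 d2] ->]; split=> //=; exact: dominatedZ.
move=> w cw; rewrite big_map (eq_big_seq (fun u => -1 * (w u.1 * w u.2))).
  by rewrite -mulr_sumr sw// mulr0.
by move=> p /ds[d1 d2] /=; rewrite (lhomZ e0 cw.1)// mulrA.
Qed.

End Orthosymmetric.

(** * The quotient by the closed ideal *)

Section ClosedIdealQuotient.
Context {R : realType} {E : banachLatticeType R} (I : orderIdeal E).
Hypothesis closedI : closed [set` I].
Implicit Types (x y z : E) (u v : vlquot I).

Local Notation q := (@quot_class R E I).

Lemma quot_class_eq x y : q x = q y <-> x - y \in ideal_pred I.
Proof. exact: VLQuotient.piP. Qed.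

Lemma quot_class_linear (a : R) x y : q (a *: x + y) = a *: q x + q y.
Proof. by rewrite /quot_class VLQuotient.piD VLQuotient.piZ. Qed.

Lemma quot_classD x y : q (x + y) = q x + q y.
Proof. exact: VLQuotient.piD. Qed.

Lemma quot_classN x : q (- x) = - q x.
Proof. exact: VLQuotient.piN. Qed.

Lemma quot_classB x y : q (x - y) = q x - q y.
Proof. exact: VLQuotient.piB. Qed.

Lemma quot_classZ (a : R) x : q (a *: x) = a *: q x.
Proof. exact: VLQuotient.piZ. Qed.

Lemma quot_class0 : q 0 = 0.
Proof. exact: VLQuotient.pi0. Qed.

Lemma quot_class_surj u : exists x, u = q x.
Proof. exact: VLQuotient.pi_surj. Qed.

Lemma quot_class_le x y : x <=| y -> q x <=| q y.
Proof. exact: VLQuotient.pi_le. Qed.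

Lemma quot_class_max x y : q (x \vee y) = q x \vee q y.
Proof. exact: VLQuotient.pi_max. Qed.

Lemma quot_class_min x y : q (x \wedge y) = q x \wedge q y.
Proof. by rewrite !vminE quot_classN quot_class_max !quot_classN. Qed.

Lemma closed_approx x : (forall d : R, 0 < d -> exists2 y,
  y \in ideal_pred I & `|x - y| < d) -> x \in ideal_pred I.
Proof.
move=> xI; apply: closedI => N /nbhs_ballP[d /= d0 dN].
have [y yI xy] := xI d d0; exists y; split=> //; apply: dN.
by rewrite -ball_normE.
Qed.

Lemma quot_norm_le x : quot_norm (q x) <= `|x|.
Proof. by apply: ge_inf; [exists 0 => _ [y _ <-]|exists x]. Qed.

Lemma quot_norm_glb u (r : R) : (forall x, q x = u -> r <= `|x|) -> r <= quot_norm u.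
Proof.
move=> ru; apply: lb_le_inf; last by move=> _ [x xu <-]; exact: ru.
by have [x ->] := quot_class_surj u; exists `|x|, x.
Qed.

Lemma quot_normD u v : quot_norm (u + v) <= quot_norm u + quot_norm v.
Proof.
rewrite -lerBlDr; apply: quot_norm_glb => x xu.
rewrite lerBlDr -lerBlDl; apply: quot_norm_glb => y yv.
rewrite lerBlDl -xu -yv -quot_classD; apply: le_trans (quot_norm_le _) _.
exact: ler_normD.
Qed.

Lemma quot_norm_eq0 u : (forall d : R, 0 < d -> quot_norm u <= d) -> u = 0.
Proof.
have [x ->] := quot_class_surj u => xd; rewrite -quot_class0; apply/quot_class_eq.
rewrite subr0; apply: closed_approx => d d0.
have [y yx yd] : exists2 y, q y = q x & `|y| < d.
  apply: contrapT => nd.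
  have : d <= d / 2.
    apply: le_trans (xd (d / 2) (divr_gt0 d0 (ltr0n _ 2))).
    apply: quot_norm_glb => y yx; rewrite leNgt; apply/negP => yd.
    by apply: nd; exists y.
  by lra.
exists (x - y); first exact/quot_class_eq.
by rewrite subKr.
Qed.

(** A representative of [u] truncated between [- z] and [z] has the same class and norm at most that
    of [z]. *)
Lemma quot_norm_solid u z : 0 <=| z -> - q z <=| u -> u <=| q z ->
  quot_norm u <= `|z|.
Proof.
have [x ->] := quot_class_surj u => z0 zx xz.
pose y := (x \wedge z) \vee (- z).
have -> : q x = q y.
  by rewrite /y quot_class_max quot_class_min quot_classN vmin_eql// vmaxC vmax_eqr.
apply: le_trans (quot_norm_le _) _; apply: ler_vnorm_pos; apply: vabs_bound.
  rewrite vmax_le vminr /= -vle_sub opprK.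
  exact: vle_add0.
by rewrite vle_oppl vmaxr.
Qed.

(** For representatives $x,y$, the elements $(x+cy)^-$ lie in the ideal and tend to $x^-$ as
    $c\to0$, so $x^-$ lies in it because it is closed. *)
Lemma quot_archimedean u v : (forall d : R, 0 < d -> - (d *: v) <=| u) -> 0 <=| u.
Proof.
have [x ->] := quot_class_surj u; have [y ->] := quot_class_surj v => xy.
suff -> : q x = q (vpos x) by rewrite -quot_class0; apply/quot_class_le/vpos_ge0.
apply/esym/quot_class_eq; rewrite -{2}(vposB x) subKr.
apply: closed_approx => d d0.
have y1 : 0 < `|y| + 1 :> R by rewrite ltr_wpDl.
pose c := d / (`|y| + 1); have c0 : 0 < c by rewrite divr_gt0.
exists (vpos (- (x + c *: y))).
  rewrite -[vpos _]subr0; apply/quot_class_eq.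
  rewrite /vpos quot_class_max quot_class0 quot_classN quot_classD quot_classZ.
  apply: vmax_eqr; rewrite -vle_opp2 opprK oppr0.
  by have := xy c c0; rewrite -vle_sub opprK.
apply: le_lt_trans (norm_vpos_lip _ _) _.
rewrite opprK addrA addNr add0r normrZ gtr0_norm// /c mulrAC ltr_pdivrMr//.
by rewrite ltr_pM2l// ltrDl.
Qed.

End ClosedIdealQuotient.

Lemma closed_ideal_closed (R : realType) (E : banachLatticeType R) (A : set E) :
  closed [set` closed_ideal A].
Proof.
move=> x cx; apply/asboolP => I cI AI; apply: (cI x) => N /cx[y [/asboolP yA Ny]].
by exists y; split=> //; exact: yA.
Qed.

Lemma closed_ideal_sub (R : realType) (E : banachLatticeType R) (A : set E) x :
  A x -> x \in ideal_pred (closed_ideal A).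
Proof. by move=> Ax; apply/asboolP => I _; apply. Qed.

Section OrderIsomorphism.
Context {R : realType} {V W : vectorLatticeType R} (T : V -> W).
Hypotheses (Tle : forall x y, T x <=| T y <-> x <=| y)
  (Tsurj : forall u, exists x, T x = u).

Lemma order_isomorphism_max x y : T (x \vee y) = T x \vee T y.
Proof.
have [z zE] := Tsurj (T x \vee T y).
apply: vle_eq; last by rewrite vmax_le !(Tle _ _).2 ?vmaxl ?vmaxr.
rewrite -zE; apply/Tle; rewrite vmax_le.
by apply/andP; split; apply/Tle; rewrite zE ?vmaxl ?vmaxr.
Qed.

Lemma order_isomorphism_min x y : T (x \wedge y) = T x \wedge T y.
Proof.
have [z zE] := Tsurj (T x \wedge T y).
apply: vle_eq; first by rewrite vle_min !(Tle _ _).2 ?vminl ?vminr.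
rewrite -zE; apply/Tle; rewrite vle_min.
by apply/andP; split; apply/Tle; rewrite zE ?vminl ?vminr.
Qed.

End OrderIsomorphism.

(** * The geometric mean as a bilinear map into $E_{(2)}$ *)

Section GeometricMean.
Context {R : realType} {E : banachLatticeType R} (hE : concavification_is_Banach E).
Implicit Types (x y : E) (a : R).

Definition concav_mean x y : concav hE := gmean x y.

Lemma gmeanC x y : gmean x y = gmean y x.
Proof.
have [e [e0 dx dy _]] := common_bound x y 0.
apply: (character_eq e0); auto with dominated => w [hw _].
by rewrite !(lhom_gmean e0 hw)// mulrC.
Qed.

(** The signed square of the mean at [w] is [w x * w y], which is linear in [x]; on the other side
    the same square linearises the operations of $E_{(2)}$. *)
Lemma gmean_linear a x x' y :
  gmean (a *: x + x') y = cvadd (cv_scale a (gmean x y)) (gmean x' y).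
Proof.
have [e [e0 dx dx' dy]] := common_bound x x' y.
apply: (character_eq e0); auto 10 with dominated => w [hw _].
rewrite (lhom_cvadd e0 hw) ?(lhom_cv_scale e0 hw) ?(lhom_gmean e0 hw);
  auto with dominated.
by rewrite hw.1// ssqM !srootK mulrDl mulrA.
Qed.

Let concav_mean_bilinear : bilinear_for *:%R *:%R concav_mean.
Proof.
split=> [y a x x'|x a y y']; first exact: gmean_linear.
by rewrite /concav_mean gmeanC gmean_linear ![gmean _ x]gmeanC.
Qed.

HB.instance Definition _ :=
  bilinear_isBilinear.Build R E E (concav hE) *:%R *:%R concav_mean concav_mean_bilinear.

Lemma concav_mean_positive : positive_bilinear concav_mean.
Proof.
move=> x y x0 y0; have [e [e0 dx dy _]] := common_bound x y 0.
change (0 <=| gmean x y); apply: (character_ge0 e0); auto with dominated => w [hw _].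
have pos z : dominated e z -> 0 <=| z -> 0 <= w z.
  by move=> dz z0; rewrite -(lhom0 e0 hw); apply: (lhom_le hw); auto with dominated.
by rewrite (lhom_gmean e0 hw)// sroot_ge0 ?sqrtr_ge0// mulr_ge0 ?pos.
Qed.

Lemma concav_mean_contractive : contractive_bilinear concav_mean.
Proof. by move=> x y x1 y1; exact: cv_norm_gmean. Qed.

Lemma gmean_abs x : gmean x (vabs x) = x.
Proof.
have [e [e0 dx _ _]] := common_bound x x x.
apply: (character_eq e0); auto with dominated => w [hw _].
rewrite (lhom_gmean e0 hw) ?(lhom_abs e0 hw); auto with dominated.
by rewrite -ssqE ssqK.
Qed.

Lemma gmean_disjoint x y : vdisjoint x y -> gmean (vabs x) (vabs y) = 0.
Proof.
move=> xy; have [e [e0 dx dy d0]] := common_bound x y 0.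
apply: (character_eq e0); auto with dominated => w [hw _].
rewrite (lhom_gmean e0 hw) ?(lhom0 e0 hw) ?(lhom_abs e0 hw); auto with dominated.
have := lhom_min e0 hw (dominated_vabs e0 dx) (dominated_vabs e0 dy).
rewrite xy (lhom0 e0 hw) !(lhom_abs e0 hw)//.
by case: leP => _ <-; rewrite ?mul0r ?mulr0 sroot0.
Qed.

End GeometricMean.

(** * The map $T$ and its inverse *)

Section TensorSquare.
Context {R : realType} {E P : banachLatticeType R} {tens : {bilinear E -> E -> P}}.
Hypotheses (hP : is_fremlin_tensor tens) (hE : concavification_is_Banach E).
Implicit Types (x y z e : E) (a d : R) (w : E -> R).

Local Notation q := (@quot_class R P (I_oc tens)).

Let closedI : closed [set` I_oc tens]. Proof. exact: closed_ideal_closed. Qed.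

Definition tensor_class x y : vlquot (I_oc tens) := q (tens x y).

Let tensor_class_bilinear : bilinear_for *:%R *:%R tensor_class.
Proof.
split=> [y a x x'|x a y y']; rewrite /tensor_class.
  by rewrite linearDl linearZl_LR quot_class_linear.
by rewrite linearDr linearZr_LR quot_class_linear.
Qed.

HB.instance Definition _ := bilinear_isBilinear.Build R E E (vlquot (I_oc tens))
  *:%R *:%R tensor_class tensor_class_bilinear.

Lemma tensor_class_positive : positive_bilinear tensor_class.
Proof.
move=> x y x0 y0; have -> : 0 = q 0 by rewrite quot_class0.
by apply: quot_class_le; exact: tensor_positive.
Qed.

Lemma tensor_class_disjoint x y : vdisjoint x y -> tensor_class x y = 0.
Proof.
move=> xy; rewrite -(quot_class0 (I_oc tens)); apply/quot_class_eq.
by rewrite subr0; apply: closed_ideal_sub; exists x, y.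
Qed.

Lemma tensor_class_ge0 e (s : seq (E * E)) : 0 <=| e ->
  (forall u, u \in s -> dominated e u.1 /\ dominated e u.2) ->
  (forall w, character e w -> 0 <= \sum_(u <- s) w u.1 * w u.2) ->
  0 <=| tensor_eval tensor_class s.
Proof.
apply: orthosymmetric_ge0 => //; first exact: tensor_class_positive.
- exact: tensor_class_disjoint.
- exact: quot_archimedean closedI.
Qed.

Lemma tensor_class_eq0 e (s : seq (E * E)) : 0 <=| e ->
  (forall u, u \in s -> dominated e u.1 /\ dominated e u.2) ->
  (forall w, character e w -> \sum_(u <- s) w u.1 * w u.2 = 0) ->
  tensor_eval tensor_class s = 0.
Proof.
apply: orthosymmetric_eq0 => //; first exact: tensor_class_positive.
- exact: tensor_class_disjoint.
- exact: quot_archimedean closedI.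
Qed.

Lemma tensor_class_eval s : tensor_eval tensor_class s = q (tensor_eval tens s).
Proof. by rewrite /tensor_eval (big_morph q (quot_classD _) (quot_class0 _)). Qed.

Definition square_class x : vlquot (I_oc tens) := tensor_class x (vabs x).

Local Notation T := square_class.

(** The difference is represented by three elementary tensors whose sum at a character is
    $\sigma(w(x\oplus y))-\sigma(w(x))-\sigma(w(y))=0$, where $\sigma$ is the signed square. *)
Lemma square_classD x y : T (cvadd x y) = T x + T y.
Proof.
have [e [e0 dx dy _]] := common_bound x y 0.
apply/eqP; rewrite -subr_eq0; apply/eqP.
have := @tensor_class_eq0 e
  [:: (cvadd x y, vabs (cvadd x y)); (- x, vabs x); (- y, vabs y)] e0.
rewrite /tensor_eval !big_cons big_nil addr0 /= !linearNl opprD; apply.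
  move=> u; rewrite !inE => /or3P[]/eqP -> /=; split; auto with dominated.
move=> w [hw _]; rewrite !big_cons big_nil addr0 /=.
rewrite !(lhom_abs e0 hw) ?(lhomN e0 hw) ?(lhom_cvadd e0 hw); auto with dominated.
by rewrite -ssqE srootK !mulNr -!ssqE; ring.
Qed.

Lemma square_classZ a x : T (cv_scale a x) = a *: T x.
Proof.
rewrite /square_class vabs_cv_scale !cv_scaleE linearZl_LR linearZr_LR /= scalerA.
by rewrite -sroot_abs -ssqE srootK.
Qed.

Lemma square_class_le x y : x <=| y -> T x <=| T y.
Proof.
move=> xy; have [e [e0 dx dy _]] := common_bound x y 0.
rewrite -vle_sub; have := @tensor_class_ge0 e [:: (y, vabs y); (- x, vabs x)] e0.
rewrite /tensor_eval !big_cons big_nil addr0 /= !linearNl; apply.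
  by move=> u; rewrite !inE => /orP[]/eqP -> /=; split; auto with dominated.
move=> w [hw _]; rewrite !big_cons big_nil addr0 /=.
rewrite !(lhom_abs e0 hw) ?(lhomN e0 hw); auto with dominated.
rewrite mulNr -!ssqE subr_ge0; apply: ssq_le; exact: (lhom_le hw).
Qed.

(** Both sides have value [w x * w y] at each character. This is what makes $T$ a left inverse of
    $S$ modulo $I_{\rm oc}$ on elementary tensors. *)
Lemma square_class_gmean x y : T (gmean x y) = tensor_class x y.
Proof.
have [e [e0 dx dy _]] := common_bound x y 0.
apply/eqP; rewrite -subr_eq0; apply/eqP.
have := @tensor_class_eq0 e [:: (gmean x y, vabs (gmean x y)); (- x, y)] e0.
rewrite /tensor_eval !big_cons big_nil addr0 /= !linearNl; apply.
  by move=> u; rewrite !inE => /orP[]/eqP -> /=; split; auto with dominated.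
move=> w [hw _]; rewrite !big_cons big_nil addr0 /=.
rewrite !(lhom_abs e0 hw) ?(lhomN e0 hw) ?(lhom_gmean e0 hw); auto with dominated.
by rewrite -ssqE srootK mulNr subrr.
Qed.

Lemma square_class0 : T 0 = 0.
Proof. by rewrite /square_class linear0l. Qed.

Lemma square_classN x : T (- x) = - T x.
Proof. by rewrite -cv_scaleN1 square_classZ scaleN1r. Qed.

Lemma square_class_norm_le x : quot_norm (T x) <= cv_norm x.
Proof.
apply: cv_norm_glb => r [s [s0 xs ->]].
(* The class of [t] is $T$ of the cover of $|x|$, so it bounds both $Tx$ and $-Tx$, while the norm
   of [t] is at most the sum of the squared norms. *)
pose t := \sum_(v <- s) tens v (vabs v).
have t0 : 0 <=| t.
  rewrite /t big_seq; apply: (big_ind (fun u => 0 <=| u)); first exact: vlexx.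
    exact: vle_add0.
  by move=> v /s0 v0; apply: (tensor_positive hP) => //; exact: vabs_ge0.
have tE : q t = T (\big[cvadd/0]_(v <- s) v).
  rewrite (big_morph T square_classD square_class0).
  exact: (big_morph q (quot_classD _) (quot_class0 _)).
apply: (@le_trans _ _ `|t|).
  apply: (quot_norm_solid t0); rewrite tE.
    rewrite -square_classN; apply: square_class_le.
    by rewrite vle_oppl; apply: vle_trans' xs; exact: lerN_vabs.
  by apply: square_class_le; apply: vle_trans' xs; exact: ler_vabs.
apply: le_trans (ler_norm_sum _ _ _) _; apply: ler_sum => v _.
by have := tensor_norm_le hP v (vabs v); rewrite norm_vabs expr2.
Qed.

Section Inverse.
Variable S : P -> concav hE.
Hypotheses (Slin : forall a u v, S (a *: u + v) = a *: S u + S v)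
  (Snorm : forall u, `|S u| <= `|u|)
  (Spos : forall u, 0 <=| u -> 0 <=| S u)
  (Seval : forall s, S (tensor_eval tens s) = tensor_eval (concav_mean hE) s).

Let S0 : S 0 = 0.
Proof. by have := Seval [::]; rewrite /tensor_eval !big_nil. Qed.

Let SZ a u : S (a *: u) = a *: S u.
Proof. by have := Slin a u 0; rewrite S0 !addr0. Qed.

Let SD u v : S (u + v) = S u + S v.
Proof. by have := Slin 1 u v; rewrite !scale1r. Qed.

Let SB u v : S (u - v) = S u - S v.
Proof. by rewrite SD -scaleN1r SZ scaleN1r. Qed.

Let Sle u v : u <=| v -> S u <=| S v.
Proof. by move=> uv; rewrite -vle_sub -SB; apply: Spos; rewrite vle_sub. Qed.

Let kernel_pred : {pred P} := fun u => `[< S (vabs u) = 0 >].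

Let kernel_le u v : S (vabs v) = 0 -> vabs u <=| v -> S (vabs u) = 0.
Proof.
move=> v0 uv; apply: vle_eq; last by apply: Spos; exact: vabs_ge0.
by rewrite -v0; apply: Sle; apply: vle_trans' uv _; exact: ler_vabs.
Qed.

Let kernel_submod : submod_closed kernel_pred.
Proof.
split=> [|a u v /asboolP u0 /asboolP v0]; apply/asboolP; first by rewrite vabs0.
apply: (kernel_le (v := `|a| *: vabs u + vabs v)); last first.
  by apply: vle_trans' (vabsD _ _) _; rewrite vabsZ vlexx.
rewrite vabs_ge0_id; first by rewrite Slin u0 v0 scaler0 addr0.
by apply: vle_add0; [apply: vscale_ge0|]; rewrite ?vabs_ge0.
Qed.

Let kernel_solid : is_solid [set` kernel_pred].
Proof.
move=> u v /asboolP v0 uv; apply/asboolP; apply: (kernel_le _ uv).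
by rewrite vabs_id.
Qed.

(* The kernel of S contains the closed ideal of all u with S |u| = 0. *)
Lemma inverse_vanishes u : u \in ideal_pred (I_oc tens) -> S u = 0.
Proof.
move=> /asboolP/(_ (OrderIdeal kernel_submod kernel_solid)) uI.
have /asboolP Su : u \in kernel_pred.
  apply: uI => [v cv|_ [x [y [xy ->]]]].
    apply/asboolP/normr0_eq0/le_anti; rewrite normr_ge0 andbT.
    apply/ler_addgt0Pr => d d0; rewrite add0r.
    have [v' [/asboolP v0]] := cv _ (nbhsx_ballx v d d0).
    rewrite -ball_normE /= => vv'; apply: ltW; apply: le_lt_trans vv'.
    apply: le_trans (norm_vabs_lip _ _).
    by have := Snorm (vabs v - vabs v'); rewrite SB v0 subr0.
  apply/asboolP; apply: (kernel_le (v := tens (vabs x) (vabs y))).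
    rewrite vabs_ge0_id; last by apply: (tensor_positive hP); exact: vabs_ge0.
    rewrite -(tensor_eval1 tens) Seval tensor_eval1.
    by change (gmean (vabs x) (vabs y) = 0); exact: gmean_disjoint.
  have := positive_bilinear_abs (tensor_positive hP); move=> h.
  apply: vabs_bound; last by rewrite vle_oppl; exact: h.
  by have := h (- x) y; rewrite vabsN linearNl vle_opp2.
apply: vle_eq; first by rewrite -Su; apply: Sle; exact: ler_vabs.
rewrite -vle_opp2 oppr0 -[X in _ <=| X]Su -scaleN1r -SZ scaleN1r.
by apply: Sle; exact: lerN_vabs.
Qed.

Lemma square_class_inverse u : T (S u) = q u.
Proof.
have TD (x y : concav hE) : T (x + y) = T x + T y by exact: square_classD.
have TN (x : concav hE) : T (- x) = - T x by exact: square_classN.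
apply/eqP; rewrite -subr_eq0; apply/eqP; apply: (quot_norm_eq0 closedI) => d d0.
have d2 : 0 < d / 2 by rewrite divr_gt0.
have [s us] := tensor_dense hP u d2.
have Ts : T (S (tensor_eval tens s)) = q (tensor_eval tens s).
  rewrite Seval -tensor_class_eval /tensor_eval.
  rewrite (big_morph (T : concav hE -> _) TD square_class0).
  by apply: eq_bigr => p _; exact: square_class_gmean.
set v := tensor_eval tens s in us Ts.
(* The identity holds at the algebraic tensor [v]; each remaining term has norm at most that of
   [u - v]. *)
have -> : T (S u) - q u = T (S (u - v)) + q (v - u).
  by rewrite SB TD TN Ts quot_classB subrKA.
apply: le_trans (quot_normD _ _) _; rewrite [d]splitr; apply: lerD.
  apply: le_trans (square_class_norm_le _) _.
  change (`|S (u - v)| <= d / 2); apply: le_trans (Snorm _) _; exact: ltW.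
by apply: le_trans (quot_norm_le _ _) _; rewrite distrC ltW.
Qed.

Lemma inverse_square x : S (tens x (vabs x)) = x.
Proof.
rewrite -(tensor_eval1 tens) Seval tensor_eval1.
by change (gmean x (vabs x) = x); exact: gmean_abs.
Qed.

(** Every representative of [T x] is mapped to [x] by the contraction [S], so its norm is at least
    that of [x] in $E_{(2)}$. *)
Lemma square_class_norm x : quot_norm (T x) = cv_norm x.
Proof.
apply/le_anti; rewrite square_class_norm_le; apply: quot_norm_glb => u.
move=> /quot_class_eq/inverse_vanishes; rewrite SB inverse_square => /eqP.
by rewrite subr_eq0 => /eqP <-; exact: Snorm.
Qed.

(** The quotient order supplies a positive representative of the difference, and the positive map
    [S] sends it to the difference of [y] and [x] in $E_{(2)}$, whose order is that of $E$. *)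
Lemma square_class_reflects x y : T x <=| T y -> x <=| y.
Proof.
move=> /asboolP[p p0 pE].
have : q (tens y (vabs y) - tens x (vabs x)) = q p by rewrite quot_classB.
move=> /quot_class_eq/inverse_vanishes; rewrite !SB !inverse_square => /eqP.
rewrite subr_eq0 => /eqP yx.
have : (0 : concav hE) <=| (y : concav hE) - (x : concav hE).
  by rewrite yx; exact: Spos.
by rewrite vle_sub.
Qed.


End Inverse.
End TensorSquare.

Theorem corollary13 (R : realType) (E P : banachLatticeType R)
    (tens : {bilinear E -> E -> P}) (hP : is_fremlin_tensor tens)
    (hE2 : concavification_is_Banach E) :
  let T := fun x : E => quot_class (I_oc tens) (tens x (vabs x)) in
  [/\ (forall x y : E, T (cv_add x y) = T x + T y) /\
      (forall (a : R) (x : E), T (cv_scale a x) = a *: T x),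
      (forall x y : E, T (x \vee y) = T x \vee T y) /\
      (forall x y : E, T (x \wedge y) = T x \wedge T y),
      forall x : E, quot_norm (T x) = cv_norm x
    & forall u : vlquot (I_oc tens), exists x : E, T x = u].
Proof.
move=> T.
have [S [Slin Snorm Spos Seval]] := fremlin_universal hP
  (concav_mean_positive hE2) (concav_mean_contractive hE2).
have Tsurj u : exists x, T x = u.
  have [a ->] := quot_class_surj u; exists (S a).
  exact: (square_class_inverse hP Slin Snorm Seval).
(* Together with surjectivity this makes [T] an order isomorphism, from which the lattice identities
   follow. *)
have Tle x y : T x <=| T y <-> x <=| y.
  split; last exact: square_class_le.
  exact: (square_class_reflects hP Slin Snorm Spos Seval).
split=> //.
- by split=> [x y|a x]; [rewrite cv_addEcvadd; exact: square_classD|exact: square_classZ].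
- by split=> x y; [exact: order_isomorphism_max|exact: order_isomorphism_min].
- exact: (square_class_norm hP Slin Snorm Spos Seval).
Qed.
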